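(* For every bicategory $A$ and every $2$-category $B$, the composite $2$-functor $$\mathbf{Ps}(\mathbf{st}A,B)\longrightarrow\mathbf{Hom}(\mathbf{st}A,B)\xrightarrow{\ \mathbf{Hom}(\eta_A,1)\ }\mathbf{Hom}(A,B),$$ of the inclusion followed by precomposition with $\eta_A\colon A\to\mathbf{st}A$, is an isomorphism of $2$-categories.
   Context: For bicategories $A,B$, $\mathbf{Hom}(A,B)$ is the bicategory of pseudofunctors $A\to B$, pseudonatural transformations and modifications; it is a $2$-category when $B$ is a $2$-category. For $2$-categories $A,B$, $\mathbf{Ps}(A,B)$ is the full sub-$2$-category of $\mathbf{Hom}(A,B)$ on the (strict) $2$-functors (so its morphisms are pseudonatural transformations and its $2$-cells are modifications). Strictification: for a path $f_1\colon a_0\to a_1,\ldots,f_n\colon a_{n-1}\to a_n$ ($n\ge 0$) of morphisms in a bicategory $A$, define $\varepsilon(f_1,\ldots,f_n)\colon a_0\to a_n$ by $\varepsilon()=1$, $\varepsilon(f)=f$, and $\varepsilon(f_1,\ldots,f_n)=f_n\cdot\varepsilon(f_1,\ldots,f_{n-1})$ for $n\ge2$. The strictification $\mathbf{st}A$ of $A$ is the $2$-category with the same objects as $A$, whose morphisms $a\to b$ are paths of morphisms of $A$ from $a$ to $b$, composed by concatenation, and whose $2$-cells $(f_1,\ldots,f_n)\to(g_1,\ldots,g_m)$ are the $2$-cells $\varepsilon(f_1,\ldots,f_n)\to\varepsilon(g_1,\ldots,g_m)$ of $A$. Vertical composition of $2$-cells is as in $A$; the horizontal composite of two $2$-cells is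 their horizontal composite in $A$ pre- and post-composed with the canonical coherence isomorphisms of $A$. The pseudofunctor $\eta_A\colon A\to\mathbf{st}A$ is the identity on objects, sends a morphism $f$ to the unary path $(f)$ and a $2$-cell $\alpha\colon f\to g$ to the $2$-cell $(f)\to(g)$ given by $\alpha$; its unit constraint $()\to(1_a)$ and composition constraint $(f,g)\to(g\cdot f)$ are the $2$-cells of $\mathbf{st}A$ given by identity $2$-cells of $A$. *)

(* Defs.v *)
From Stdlib Require Import ssreflect FunctionalExtensionality ProofIrrelevance.

Set Implicit Arguments.
Unset Strict Implicit.
Unset Printing Implicit Defensive.

Reserved Notation "g ∘ f" (at level 40, left associativity).
Reserved Notation "y ∗ x" (at level 42, left associativity).
Reserved Notation "g ◁ x" (at level 42, left associativity).
Reserved Notation "y ▷ f" (at level 42, left associativity).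
Reserved Notation "y • x" (at level 48, right associativity).
Reserved Notation "f ⟹ g" (at level 70).

Declare Scope bicat_scope.
Delimit Scope bicat_scope with bicat.
Open Scope bicat_scope.

Record bicategory := Bicategory {
  ob :> Type;
  hom : ob -> ob -> Type;
  cell : forall a b, hom a b -> hom a b -> Type
    where "f ⟹ g" := (cell f g);
  id1 : forall a, hom a a;
  comp1 : forall a b c, hom b c -> hom a b -> hom a c
    where "g ∘ f" := (comp1 g f);
  id2 : forall a b (f : hom a b), f ⟹ f;
  vcomp : forall a b (f g h : hom a b), g ⟹ h -> f ⟹ g -> f ⟹ h
    where "y • x" := (vcomp y x);
  hcomp : forall a b c (g g' : hom b c) (f f' : hom a b),
    g ⟹ g' -> f ⟹ f' -> g ∘ f ⟹ g' ∘ f'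
    where "y ∗ x" := (hcomp y x);
  assoc : forall a b c d (h : hom c d) (g : hom b c) (f : hom a b),
    (h ∘ g) ∘ f ⟹ h ∘ (g ∘ f);
  assoc_inv : forall a b c d (h : hom c d) (g : hom b c) (f : hom a b),
    h ∘ (g ∘ f) ⟹ (h ∘ g) ∘ f;
  lunit : forall a b (f : hom a b), id1 b ∘ f ⟹ f;
  lunit_inv : forall a b (f : hom a b), f ⟹ id1 b ∘ f;
  runit : forall a b (f : hom a b), f ∘ id1 a ⟹ f;
  runit_inv : forall a b (f : hom a b), f ⟹ f ∘ id1 a;

  vcompA : forall a b (f g h k : hom a b)
    (z : h ⟹ k) (y : g ⟹ h) (x : f ⟹ g), (z • y) • x = z • (y • x);
  vcomp1c : forall a b (f g : hom a b) (x : f ⟹ g), id2 g • x = x;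
  vcompc1 : forall a b (f g : hom a b) (x : f ⟹ g), x • id2 f = x;

  hcomp_id2 : forall a b c (g : hom b c) (f : hom a b),
    id2 g ∗ id2 f = id2 (g ∘ f);
  hcomp_vcomp : forall a b c (g g' g'' : hom b c) (f f' f'' : hom a b)
    (y' : g' ⟹ g'') (y : g ⟹ g') (x' : f' ⟹ f'') (x : f ⟹ f'),
    (y' • y) ∗ (x' • x) = (y' ∗ x') • (y ∗ x);

  assocK : forall a b c d (h : hom c d) (g : hom b c) (f : hom a b),
    assoc_inv h g f • assoc h g f = id2 _;
  assoc_invK : forall a b c d (h : hom c d) (g : hom b c) (f : hom a b),
    assoc h g f • assoc_inv h g f = id2 _;
  lunitK : forall a b (f : hom a b), lunit_inv f • lunit f = id2 _;
  lunit_invK : forall a b (f : hom a b), lunit f • lunit_inv f = id2 _;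
  runitK : forall a b (f : hom a b), runit_inv f • runit f = id2 _;
  runit_invK : forall a b (f : hom a b), runit f • runit_inv f = id2 _;

  assoc_nat : forall a b c d (h h' : hom c d) (g g' : hom b c) (f f' : hom a b)
    (z : h ⟹ h') (y : g ⟹ g') (x : f ⟹ f'),
    assoc h' g' f' • ((z ∗ y) ∗ x) = (z ∗ (y ∗ x)) • assoc h g f;
  lunit_nat : forall a b (f f' : hom a b) (x : f ⟹ f'),
    lunit f' • (id2 (id1 b) ∗ x) = x • lunit f;
  runit_nat : forall a b (f f' : hom a b) (x : f ⟹ f'),
    runit f' • (x ∗ id2 (id1 a)) = x • runit f;

  pentagon : forall a b c d e
    (k : hom d e) (h : hom c d) (g : hom b c) (f : hom a b),
    assoc k h (g ∘ f) • assoc (k ∘ h) g f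
    = (id2 k ∗ assoc h g f) • (assoc k (h ∘ g) f • (assoc k h g ∗ id2 f));
  triangle : forall a b c (g : hom b c) (f : hom a b),
    (id2 g ∗ lunit f) • assoc g (id1 b) f = runit g ∗ id2 f
}.

Arguments hom {_} _ _.
Arguments cell {_ _ _} _ _.
Arguments id1 {_} _.
Arguments comp1 {_ _ _ _} _ _.
Arguments id2 {_ _ _} _.
Arguments vcomp {_ _ _ _ _ _} _ _.
Arguments hcomp {_ _ _ _ _ _ _ _} _ _.
Arguments assoc {_ _ _ _ _} _ _ _.
Arguments assoc_inv {_ _ _ _ _} _ _ _.
Arguments lunit {_ _ _} _.
Arguments lunit_inv {_ _ _} _.
Arguments runit {_ _ _} _.
Arguments runit_inv {_ _ _} _.

Notation "f ⟹ g" := (cell f g) : bicat_scope.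
Notation "g ∘ f" := (comp1 g f) : bicat_scope.
Notation "y • x" := (vcomp y x) : bicat_scope.
Notation "y ∗ x" := (hcomp y x) : bicat_scope.
Notation "g ◁ x" := (hcomp (id2 g) x) : bicat_scope.
Notation "y ▷ f" := (hcomp y (id2 f)) : bicat_scope.

Definition invertible (A : bicategory) (a b : A) (f g : hom a b) (x : f ⟹ g) :=
  exists y : g ⟹ f, y • x = id2 f /\ x • y = id2 g.

(** A 2-category is a bicategory whose associativity and unit constraints are
    identities: the two 1-cells are equal, and the constraint is the identity
    2-cell transported along that equality. *)

Definition eq_to_cell (A : bicategory) (a b : A) (f g : hom a b) (e : f = g) :
  f ⟹ g := match e in _ = h return f ⟹ h with eq_refl => id2 f end.

Definition is_identity (A : bicategory) (a b : A) (f g : hom a b) (x : f ⟹ g) :=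
  exists e : f = g, x = eq_to_cell e.

Record is_strict (A : bicategory) : Prop := IsStrict {
  strict_assoc : forall (a b c d : A) (h : hom c d) (g : hom b c) (f : hom a b),
    is_identity (assoc h g f);
  strict_lunit : forall (a b : A) (f : hom a b), is_identity (lunit f);
  strict_runit : forall (a b : A) (f : hom a b), is_identity (runit f)
}.

Record two_category := TwoCategory {
  two_bicat :> bicategory;
  two_strict : is_strict two_bicat
}.

Section Coherence.
Variable A : bicategory.
Implicit Types a b c d e : A.

Lemma vrea a b (f g h k : hom a b) (x : g ⟹ h) (y : f ⟹ g) (z : f ⟹ h) :
  x • y = z -> forall w : k ⟹ f, x • (y • w) = z • w.
Proof. by move=> <- w; rewrite vcompA. Qed.

Lemma whiskerl_vcomp a b c (g : hom b c) (f f' f'' : hom a b)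
  (x : f' ⟹ f'') (y : f ⟹ f') : g ◁ (x • y) = (g ◁ x) • (g ◁ y).
Proof. by rewrite -hcomp_vcomp vcomp1c. Qed.

Lemma whiskerr_vcomp a b c (g g' g'' : hom b c) (f : hom a b)
  (x : g' ⟹ g'') (y : g ⟹ g') : (x • y) ▷ f = (x ▷ f) • (y ▷ f).
Proof. by rewrite -hcomp_vcomp vcomp1c. Qed.

Lemma hcomp_rl a b c (g g' : hom b c) (f f' : hom a b)
  (y : g ⟹ g') (x : f ⟹ f') : (y ▷ f') • (g ◁ x) = y ∗ x.
Proof. by rewrite -hcomp_vcomp vcomp1c vcompc1. Qed.

Lemma hcomp_lr a b c (g g' : hom b c) (f f' : hom a b)
  (y : g ⟹ g') (x : f ⟹ f') : (g' ◁ x) • (y ▷ f) = y ∗ x.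
Proof. by rewrite -hcomp_vcomp vcomp1c vcompc1. Qed.

Lemma invertible_cancell a b (f g h : hom a b) (x : g ⟹ h) (y z : f ⟹ g) :
  invertible x -> x • y = x • z -> y = z.
Proof.
move=> [w [wx _]] e.
by rewrite -[y]vcomp1c -[z]vcomp1c -wx !vcompA e.
Qed.

Lemma invertible_cancelr a b (f g h : hom a b) (x : f ⟹ g) (y z : g ⟹ h) :
  invertible x -> y • x = z • x -> y = z.
Proof.
move=> [w [_ xw]] e.
by rewrite -[y]vcompc1 -[z]vcompc1 -xw -!vcompA e.
Qed.

Lemma invertible_id2 a b (f : hom a b) : invertible (id2 f).
Proof. by exists (id2 f); rewrite vcomp1c. Qed.

Lemma invertible_vcomp a b (f g h : hom a b) (y : g ⟹ h) (x : f ⟹ g) :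
  invertible y -> invertible x -> invertible (y • x).
Proof.
move=> [y' [y1 y2]] [x' [x1 x2]]; exists (x' • y'); split.
  by rewrite !vcompA (vrea y1) vcomp1c.
by rewrite !vcompA (vrea x2) vcomp1c.
Qed.

Lemma invertible_hcomp a b c (g g' : hom b c) (f f' : hom a b)
  (y : g ⟹ g') (x : f ⟹ f') :
  invertible y -> invertible x -> invertible (y ∗ x).
Proof.
move=> [y' [y1 y2]] [x' [x1 x2]]; exists (y' ∗ x').
by rewrite -!hcomp_vcomp y1 x1 y2 x2 !hcomp_id2.
Qed.

Lemma invertible_assoc a b c d (h : hom c d) (g : hom b c) (f : hom a b) :
  invertible (assoc h g f).
Proof. by exists (assoc_inv h g f); rewrite assocK assoc_invK. Qed.

Lemma invertible_assoc_inv a b c d (h : hom c d) (g : hom b c) (f : hom a b) :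
  invertible (assoc_inv h g f).
Proof. by exists (assoc h g f); rewrite assocK assoc_invK. Qed.

Lemma invertible_lunit a b (f : hom a b) : invertible (lunit f).
Proof. by exists (lunit_inv f); rewrite lunitK lunit_invK. Qed.

Lemma invertible_lunit_inv a b (f : hom a b) : invertible (lunit_inv f).
Proof. by exists (lunit f); rewrite lunitK lunit_invK. Qed.

Lemma invertible_runit a b (f : hom a b) : invertible (runit f).
Proof. by exists (runit_inv f); rewrite runitK runit_invK. Qed.

Lemma invertible_runit_inv a b (f : hom a b) : invertible (runit_inv f).
Proof. by exists (runit f); rewrite runitK runit_invK. Qed.

Lemma assoc_inv_nat a b c d (h h' : hom c d) (g g' : hom b c) (f f' : hom a b)
  (z : h ⟹ h') (y : g ⟹ g') (x : f ⟹ f') :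
  assoc_inv h' g' f' • (z ∗ (y ∗ x)) = ((z ∗ y) ∗ x) • assoc_inv h g f.
Proof.
apply: (invertible_cancell (invertible_assoc _ _ _)).
apply: (invertible_cancelr (invertible_assoc _ _ _)).
by rewrite !vcompA assocK vcompc1 assoc_nat (vrea (assoc_invK _ _ _)) vcomp1c.
Qed.

Lemma lunit_inv_nat a b (f f' : hom a b) (x : f ⟹ f') :
  lunit_inv f' • x = (id1 b ◁ x) • lunit_inv f.
Proof.
apply: (invertible_cancell (invertible_lunit _)).
apply: (invertible_cancelr (invertible_lunit _)).
by rewrite !vcompA lunitK vcompc1 lunit_nat (vrea (lunit_invK _)) vcomp1c.
Qed.

Lemma runit_inv_nat a b (f f' : hom a b) (x : f ⟹ f') :
  runit_inv f' • x = (x ▷ id1 a) • runit_inv f.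
Proof.
apply: (invertible_cancell (invertible_runit _)).
apply: (invertible_cancelr (invertible_runit _)).
by rewrite !vcompA runitK vcompc1 runit_nat (vrea (runit_invK _)) vcomp1c.
Qed.

Lemma whiskerl_faithful a b (f f' : hom a b) (x y : f ⟹ f') :
  id1 b ◁ x = id1 b ◁ y -> x = y.
Proof.
move=> e; apply: (invertible_cancelr (invertible_lunit _)).
by rewrite -!lunit_nat e.
Qed.

Lemma whiskerr_faithful a b (f f' : hom a b) (x y : f ⟹ f') :
  x ▷ id1 a = y ▷ id1 a -> x = y.
Proof.
move=> e; apply: (invertible_cancelr (invertible_runit _)).
by rewrite -!runit_nat e.
Qed.

Lemma lunit_comp a b c (g : hom b c) (f : hom a b) :
  lunit (g ∘ f) • assoc (id1 c) g f = lunit g ▷ f.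
Proof.
apply: whiskerl_faithful; rewrite whiskerl_vcomp.
apply: (@invertible_cancelr _ _ _ _ _
  (assoc _ _ _ • (assoc (id1 c) (id1 c) g ▷ f))).
  apply: invertible_vcomp; first exact: invertible_assoc.
  by apply: invertible_hcomp; [exact: invertible_assoc | exact: invertible_id2].
rewrite vcompA -pentagon (vrea (triangle _ _)).
rewrite (vrea (eq_sym (assoc_nat _ _ _))) vcompA -whiskerr_vcomp triangle.
by rewrite assoc_nat hcomp_id2.
Qed.

Lemma runit_comp a b c (g : hom b c) (f : hom a b) :
  (g ◁ runit f) • assoc g f (id1 a) = runit (g ∘ f).
Proof.
apply: whiskerr_faithful; rewrite whiskerr_vcomp.
apply: (invertible_cancell (invertible_assoc _ _ _)).
rewrite (vrea (assoc_nat _ _ _)) -triangle whiskerl_vcomp !vcompA -pentagon.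
by rewrite -triangle -hcomp_id2 (vrea (assoc_nat _ _ _)) vcompA.
Qed.

Lemma lunit_id1 a : lunit (id1 a) = runit (id1 a).
Proof.
apply: whiskerr_faithful; rewrite -triangle -lunit_comp; congr (_ • _).
apply: (invertible_cancell (invertible_lunit (id1 a))).
by rewrite lunit_nat.
Qed.

Section MoreCoherence.
Variables (a b c d : A).

Lemma vrea3 (f g h i k : hom a b) (x : h ⟹ i) (y : g ⟹ h) (z : f ⟹ g)
  (w : f ⟹ i) : x • (y • z) = w ->
  forall v : k ⟹ f, x • (y • (z • v)) = w • v.
Proof. by move=> <- v; rewrite !vcompA. Qed.

Lemma vrea4 (f g h i j k : hom a b) (x : i ⟹ j) (y : h ⟹ i) (z : g ⟹ h)
  (t : f ⟹ g) (w : f ⟹ j) : x • (y • (z • t)) = w ->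
  forall v : k ⟹ f, x • (y • (z • (t • v))) = w • v.
Proof. by move=> <- v; rewrite !vcompA. Qed.

Lemma assoc_natl (k : hom c d) (h : hom b c) (f f' : hom a b) (x : f ⟹ f') :
  assoc k h f' • ((k ∘ h) ◁ x) = (k ◁ (h ◁ x)) • assoc k h f.
Proof. by rewrite -assoc_nat hcomp_id2. Qed.

Lemma assoc_natm (k : hom c d) (h h' : hom b c) (f : hom a b) (x : h ⟹ h') :
  assoc k h' f • ((k ◁ x) ▷ f) = (k ◁ (x ▷ f)) • assoc k h f.
Proof. exact: assoc_nat. Qed.

Lemma assoc_natr (k k' : hom c d) (h : hom b c) (f : hom a b) (x : k ⟹ k') :
  assoc k' h f • ((x ▷ h) ▷ f) = (x ▷ (h ∘ f)) • assoc k h f.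
Proof. by rewrite assoc_nat hcomp_id2. Qed.

Lemma assoc_inv_natl (k : hom c d) (h : hom b c) (f f' : hom a b)
  (x : f ⟹ f') :
  assoc_inv k h f' • (k ◁ (h ◁ x)) = ((k ∘ h) ◁ x) • assoc_inv k h f.
Proof. by rewrite assoc_inv_nat hcomp_id2. Qed.

Lemma assoc_inv_natm (k : hom c d) (h h' : hom b c) (f : hom a b)
  (x : h ⟹ h') :
  assoc_inv k h' f • (k ◁ (x ▷ f)) = ((k ◁ x) ▷ f) • assoc_inv k h f.
Proof. exact: assoc_inv_nat. Qed.

Lemma assoc_inv_natr (k k' : hom c d) (h : hom b c) (f : hom a b)
  (x : k ⟹ k') :
  assoc_inv k' h f • (x ▷ (h ∘ f)) = ((x ▷ h) ▷ f) • assoc_inv k h f.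
Proof. by rewrite -assoc_inv_nat hcomp_id2. Qed.

Lemma whiskerlK (g : hom b c) (f f' : hom a b) (x : f ⟹ f') (y : f' ⟹ f) :
  y • x = id2 f -> (g ◁ y) • (g ◁ x) = id2 (g ∘ f).
Proof. by move=> e0; rewrite -whiskerl_vcomp e0 hcomp_id2. Qed.

Lemma whiskerrK (g g' : hom b c) (f : hom a b) (x : g ⟹ g') (y : g' ⟹ g) :
  y • x = id2 g -> (y ▷ f) • (x ▷ f) = id2 (g ∘ f).
Proof. by move=> e0; rewrite -whiskerr_vcomp e0 hcomp_id2. Qed.

End MoreCoherence.

Section Pentagons.
Variables (a b c d e : A).
Variables (k : hom d e) (h : hom c d) (g : hom b c) (f : hom a b).

Lemma pentagon_lr :
  assoc k (h ∘ g) f • (assoc k h g ▷ f)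
  = (k ◁ assoc_inv h g f) • (assoc k h (g ∘ f) • assoc (k ∘ h) g f).
Proof.
by rewrite pentagon (vrea (whiskerlK _ (assocK _ _ _))) vcomp1c.
Qed.

Lemma pentagon_top :
  assoc (k ∘ h) g f • (assoc_inv k h g ▷ f)
  = assoc_inv k h (g ∘ f) • ((k ◁ assoc h g f) • assoc k (h ∘ g) f).
Proof.
apply: (invertible_cancell (invertible_assoc _ _ _)).
rewrite (vrea (assoc_invK _ _ _)) vcomp1c (vrea (pentagon _ _ _ _)) !vcompA.
by rewrite (whiskerrK _ (assoc_invK _ _ _)) vcompc1.
Qed.

Lemma pentagon_mid :
  assoc (k ∘ h) g f • ((assoc_inv k h g ▷ f) • assoc_inv k (h ∘ g) f)
  = assoc_inv k h (g ∘ f) • (k ◁ assoc h g f).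
Proof.
by rewrite (vrea pentagon_top) !vcompA assoc_invK vcompc1.
Qed.

Lemma pentagon_inv :
  assoc (k ∘ h) g f • ((assoc_inv k h g ▷ f) • (assoc_inv k (h ∘ g) f
    • (k ◁ assoc_inv h g f)))
  = assoc_inv k h (g ∘ f).
Proof.
by rewrite (vrea3 pentagon_mid) vcompA (whiskerlK _ (assoc_invK _ _ _)) vcompc1.
Qed.

Lemma pentagon_bot :
  assoc_inv k (h ∘ g) f • ((k ◁ assoc_inv h g f) • assoc k h (g ∘ f))
  = (assoc k h g ▷ f) • assoc_inv (k ∘ h) g f.
Proof.
apply: (invertible_cancell (invertible_assoc _ _ _)).
apply: (invertible_cancelr (invertible_assoc _ _ _)).
by rewrite !vcompA (vrea (assoc_invK _ _ _)) vcomp1c -pentagon_lr assocK vcompc1.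
Qed.

End Pentagons.

Lemma runit_assoc_inv a b c (g : hom b c) (f : hom a b) :
  (runit g ▷ f) • assoc_inv g (id1 b) f = g ◁ lunit f.
Proof. by rewrite -triangle vcompA assoc_invK vcompc1. Qed.

Lemma assoc_lunit_inv a b c (g : hom b c) (f : hom a b) :
  assoc (id1 c) g f • (lunit_inv g ▷ f) = lunit_inv (g ∘ f).
Proof.
apply: (invertible_cancell (invertible_lunit _)).
by rewrite (vrea (lunit_comp _ _)) lunit_invK (whiskerrK _ (lunit_invK _)).
Qed.

Lemma assoc_inv_runit_inv a b c (g : hom b c) (f : hom a b) :
  assoc_inv g f (id1 a) • (g ◁ runit_inv f) = runit_inv (g ∘ f).
Proof.
apply: (invertible_cancell (invertible_runit _)).
rewrite runit_invK -runit_comp vcompA (vrea (assoc_invK _ _ _)) vcomp1c.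
exact: whiskerlK (runit_invK _).
Qed.

Lemma lunit_assoc_inv a b c (g : hom b c) (f : hom a b) :
  (lunit g ▷ f) • assoc_inv (id1 c) g f = lunit (g ∘ f).
Proof. by rewrite -lunit_comp vcompA assoc_invK vcompc1. Qed.

Lemma unit_middle a b c (g : hom b c) (f : hom a b) :
  (g ◁ lunit f) • (assoc g (id1 b) f • (runit_inv g ▷ f)) = id2 (g ∘ f).
Proof. by rewrite (vrea (triangle _ _)) (whiskerrK _ (runit_invK _)). Qed.

End Coherence.

Record pseudofunctor (A B : bicategory) := Pseudofunctor {
  pf0 :> A -> B;
  pf1 : forall a b : A, hom a b -> hom (pf0 a) (pf0 b);
  pf2 : forall (a b : A) (f g : hom a b), f ⟹ g -> pf1 f ⟹ pf1 g;
  pf_unit : forall a : A, id1 (pf0 a) ⟹ pf1 (id1 a);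
  pf_comp : forall (a b c : A) (g : hom b c) (f : hom a b),
    pf1 g ∘ pf1 f ⟹ pf1 (g ∘ f);
  pf_unit_inv : forall a : A, invertible (pf_unit a);
  pf_comp_inv : forall (a b c : A) (g : hom b c) (f : hom a b),
    invertible (pf_comp g f);
  pf2_id2 : forall (a b : A) (f : hom a b), pf2 (id2 f) = id2 (pf1 f);
  pf2_vcomp : forall (a b : A) (f g h : hom a b) (y : g ⟹ h) (x : f ⟹ g),
    pf2 (y • x) = pf2 y • pf2 x;
  pf_comp_nat : forall (a b c : A) (g g' : hom b c) (f f' : hom a b)
    (y : g ⟹ g') (x : f ⟹ f'),
    pf2 (y ∗ x) • pf_comp g f = pf_comp g' f' • (pf2 y ∗ pf2 x);
  pf_assoc : forall (a b c d : A) (h : hom c d) (g : hom b c) (f : hom a b),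
    pf2 (assoc h g f) • (pf_comp (h ∘ g) f • (pf_comp h g ▷ pf1 f))
    = pf_comp h (g ∘ f) • ((pf1 h ◁ pf_comp g f)
      • assoc (pf1 h) (pf1 g) (pf1 f));
  pf_lunit : forall (a b : A) (f : hom a b),
    pf2 (lunit f) • (pf_comp (id1 b) f • (pf_unit b ▷ pf1 f)) = lunit (pf1 f);
  pf_runit : forall (a b : A) (f : hom a b),
    pf2 (runit f) • (pf_comp f (id1 a) • (pf1 f ◁ pf_unit a)) = runit (pf1 f)
}.

Arguments pf1 {A B} _ {a b} _.
Arguments pf2 {A B} _ {a b f g} _.
Arguments pf_unit {A B} _ _.
Arguments pf_comp {A B} _ {a b c} _ _.

Section PseudofunctorOps.

Lemma invertible_pf2 (A B : bicategory) (F : pseudofunctor A B) (a b : A)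
  (f g : hom a b) (x : f ⟹ g) : invertible x -> invertible (pf2 F x).
Proof.
by move=> [y [yx xy]]; exists (pf2 F y); rewrite -!pf2_vcomp yx xy !pf2_id2.
Qed.

Lemma pf_comp_natl (A B : bicategory) (F : pseudofunctor A B) (a b c : A)
  (g : hom b c) (f f' : hom a b) (x : f ⟹ f') :
  pf2 F (g ◁ x) • pf_comp F g f = pf_comp F g f' • (pf1 F g ◁ pf2 F x).
Proof. by rewrite pf_comp_nat pf2_id2. Qed.

Lemma pf_comp_natr (A B : bicategory) (F : pseudofunctor A B) (a b c : A)
  (g g' : hom b c) (f : hom a b) (y : g ⟹ g') :
  pf2 F (y ▷ f) • pf_comp F g f = pf_comp F g' f • (pf2 F y ▷ pf1 F f).
Proof. by rewrite pf_comp_nat pf2_id2. Qed.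

Definition pseudofunctor_id (A : bicategory) : pseudofunctor A A.
Proof.
refine {| pf0 := fun a => a; pf1 := fun _ _ f => f; pf2 := fun _ _ _ _ x => x;
  pf_unit := fun a => id2 _; pf_comp := fun _ _ _ g f => id2 _ |};
abstract by intros; rewrite ?hcomp_id2 ?vcomp1c ?vcompc1;
  first [reflexivity | exact: invertible_id2].
Defined.

Variables (A B C : bicategory) (G : pseudofunctor B C) (F : pseudofunctor A B).

Definition pseudofunctor_comp : pseudofunctor A C.
Proof.
refine {| pf0 := fun a => G (F a); pf1 := fun _ _ f => pf1 G (pf1 F f);
  pf2 := fun _ _ _ _ x => pf2 G (pf2 F x);
  pf_unit := fun a => pf2 G (pf_unit F a) • pf_unit G (F a);
  pf_comp := fun _ _ _ g f => pf2 G (pf_comp F g f)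
    • pf_comp G (pf1 F g) (pf1 F f) |}.
- abstract by move=> a; apply: invertible_vcomp;
  [apply: invertible_pf2|]; apply: pf_unit_inv.
- abstract by intros; apply: invertible_vcomp;
  [apply: invertible_pf2|]; apply: pf_comp_inv.
- abstract by intros; rewrite !pf2_id2.
- abstract by intros; rewrite !pf2_vcomp.
- abstract by intros; rewrite -vcompA -pf2_vcomp pf_comp_nat pf2_vcomp !vcompA
    pf_comp_nat.
- abstract by intros; rewrite !whiskerr_vcomp !whiskerl_vcomp !vcompA
    (vrea (eq_sym (pf_comp_natr G _ _))) (vrea (eq_sym (pf_comp_natl G _ _)))
    !vcompA -pf_assoc -!vcompA -!pf2_vcomp !vcompA -pf_assoc.
- abstract by intros; rewrite !whiskerr_vcomp !vcompA
    (vrea (eq_sym (pf_comp_natr G _ _))) -[in RHS]pf_lunit -!vcompA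
    -!pf2_vcomp -pf_lunit !vcompA.
- abstract by intros; rewrite !whiskerl_vcomp !vcompA
    (vrea (eq_sym (pf_comp_natl G _ _))) -[in RHS]pf_runit -!vcompA
    -!pf2_vcomp -pf_runit !vcompA.
Defined.

End PseudofunctorOps.

Record pseudonat (A B : bicategory) (F G : pseudofunctor A B) := Pseudonat {
  pn0 :> forall a : A, hom (F a) (G a);
  pn1 : forall (a b : A) (f : hom a b), pn0 b ∘ pf1 F f ⟹ pf1 G f ∘ pn0 a;
  pn1_inv : forall (a b : A) (f : hom a b), invertible (pn1 f);
  pn1_nat : forall (a b : A) (f g : hom a b) (x : f ⟹ g),
    pn1 g • (pn0 b ◁ pf2 F x) = (pf2 G x ▷ pn0 a) • pn1 f;
  pn1_unit : forall a : A,
    pn1 (id1 a) • (pn0 a ◁ pf_unit F a)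
    = (pf_unit G a ▷ pn0 a) • (lunit_inv (pn0 a) • runit (pn0 a));
  pn1_comp : forall (a b c : A) (g : hom b c) (f : hom a b),
    pn1 (g ∘ f) • (pn0 c ◁ pf_comp F g f)
    = (pf_comp G g f ▷ pn0 a) • (assoc_inv (pf1 G g) (pf1 G f) (pn0 a)
      • ((pf1 G g ◁ pn1 f) • (assoc (pf1 G g) (pn0 b) (pf1 F f)
      • ((pn1 g ▷ pf1 F f) • assoc_inv (pn0 c) (pf1 F g) (pf1 F f)))))
}.

Arguments pn1 {A B F G} _ {a b} _.

Record modification (A B : bicategory) (F G : pseudofunctor A B)
    (s t : pseudonat F G) := Modification {
  md0 :> forall a : A, s a ⟹ t a;
  md0_nat : forall (a b : A) (f : hom a b),
    pn1 t f • (md0 b ▷ pf1 F f) = (pf1 G f ◁ md0 a) • pn1 s f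
}.

Section HomCategory.
Variables (A B : bicategory) (F G : pseudofunctor A B).

Lemma modification_eq (s t : pseudonat F G) (m n : modification s t) :
  (forall a, m a = n a) -> m = n.
Proof.
case: m n => [m mP] [n nP] /= e.
have {}e : m = n by apply: functional_extensionality_dep.
by case: n / e nP => nP; congr Modification; apply: proof_irrelevance.
Qed.

Definition modification_id (s : pseudonat F G) : modification s s.
Proof.
refine {| md0 := fun a => id2 (s a) |}.
abstract by intros; rewrite !hcomp_id2 vcomp1c vcompc1.
Defined.

Definition modification_vcomp (s t u : pseudonat F G)
  (n : modification t u) (m : modification s t) : modification s u.
Proof.
refine {| md0 := fun a => n a • m a |}.
abstract by intros; rewrite whiskerr_vcomp whiskerl_vcomp !vcompA -md0_nat
  -!vcompA md0_nat.
Defined.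

End HomCategory.

Section HomOps.
Variables (A B : bicategory).

Definition pseudonat_id (F : pseudofunctor A B) : pseudonat F F.
Proof.
refine {| pn0 := fun a => id1 (F a);
  pn1 := fun a b f => runit_inv (pf1 F f) • lunit (pf1 F f) |}.
- abstract by intros; apply: invertible_vcomp;
  [apply: invertible_runit_inv | apply: invertible_lunit].
- abstract by intros; rewrite vcompA lunit_nat -!vcompA runit_inv_nat.
- abstract by intros; rewrite vcompA lunit_nat -vcompA runit_inv_nat vcompA
    lunit_id1 runitK -lunit_id1 lunitK.
- abstract by intros; rewrite !whiskerl_vcomp !whiskerr_vcomp !vcompA lunit_nat
    -[lunit (_ ∘ _)]vcompc1 -(assoc_invK (id1 _)) (vrea (lunit_comp _ _))
    (vrea (assoc_inv_runit_inv _ _)) (vrea3 (unit_middle _ _))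
    vcomp1c -!vcompA runit_inv_nat.
Defined.

Section Comp.
Variables (F G H : pseudofunctor A B) (t : pseudonat G H) (s : pseudonat F G).

Definition pseudonat_comp1 (a b : A) (f : hom a b) :
    (t b ∘ s b) ∘ pf1 F f ⟹ pf1 H f ∘ (t a ∘ s a) :=
  assoc (pf1 H f) (t a) (s a) • ((pn1 t f ▷ s a)
    • (assoc_inv (t b) (pf1 G f) (s a)
    • ((t b ◁ pn1 s f) • assoc (t b) (s b) (pf1 F f)))).

Lemma pseudonat_comp_inv (a b : A) (f : hom a b) :
  invertible (pseudonat_comp1 f).
Proof.
repeat apply: invertible_vcomp;
  first [apply: invertible_assoc | apply: invertible_assoc_inv
  | apply: invertible_hcomp; first [apply: pn1_inv | apply: invertible_id2]].
Qed.

Lemma pseudonat_comp_nat (a b : A) (f g : hom a b) (x : f ⟹ g) :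
  pseudonat_comp1 g • ((t b ∘ s b) ◁ pf2 F x)
  = (pf2 H x ▷ (t a ∘ s a)) • pseudonat_comp1 f.
Proof.
rewrite /pseudonat_comp1 !vcompA assoc_natl.
rewrite (vrea (eq_sym (whiskerl_vcomp _ _ _))) pn1_nat whiskerl_vcomp !vcompA.
rewrite (vrea (assoc_inv_natm _ _ _)) !vcompA.
rewrite (vrea (eq_sym (whiskerr_vcomp _ _ _))) pn1_nat whiskerr_vcomp !vcompA.
by rewrite (vrea (assoc_natr _ _ _)) !vcompA.
Qed.

Lemma pseudonat_comp_unit (a : A) :
  pseudonat_comp1 (id1 a) • ((t a ∘ s a) ◁ pf_unit F a)
  = (pf_unit H a ▷ (t a ∘ s a))
    • (lunit_inv (t a ∘ s a) • runit (t a ∘ s a)).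
Proof.
rewrite /pseudonat_comp1 !vcompA assoc_natl.
rewrite (vrea (eq_sym (whiskerl_vcomp _ _ _))) pn1_unit !whiskerl_vcomp !vcompA.
rewrite runit_comp (vrea (assoc_inv_natm _ _ _)) !vcompA.
rewrite (vrea (eq_sym (whiskerr_vcomp _ _ _))) pn1_unit !whiskerr_vcomp !vcompA.
rewrite (vrea (runit_assoc_inv _ _)).
rewrite (vrea (whiskerlK _ (lunit_invK _))) vcomp1c.
by rewrite (vrea (assoc_natr _ _ _)) !vcompA (vrea (assoc_lunit_inv _ _)).
Qed.

Lemma pseudonat_comp_comp (a b c : A) (g : hom b c) (f : hom a b) :
  pseudonat_comp1 (g ∘ f) • ((t c ∘ s c) ◁ pf_comp F g f)
  = (pf_comp H g f ▷ (t a ∘ s a))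
    • (assoc_inv (pf1 H g) (pf1 H f) (t a ∘ s a)
    • ((pf1 H g ◁ pseudonat_comp1 f)
    • (assoc (pf1 H g) (t b ∘ s b) (pf1 F f)
    • ((pseudonat_comp1 g ▷ pf1 F f)
    • assoc_inv (t c ∘ s c) (pf1 F g) (pf1 F f))))).
Proof.
rewrite /pseudonat_comp1 !vcompA assoc_natl.
rewrite (vrea (eq_sym (whiskerl_vcomp _ _ _))) pn1_comp whiskerl_vcomp !vcompA.
rewrite (vrea (assoc_inv_natm _ _ _)) !vcompA.
rewrite (vrea (eq_sym (whiskerr_vcomp _ _ _))) pn1_comp whiskerr_vcomp !vcompA.
rewrite (vrea (assoc_natr _ _ _)) !vcompA; congr (_ • _).
rewrite !whiskerr_vcomp !whiskerl_vcomp !vcompA.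
rewrite (vrea (pentagon_top _ _ _ _)) !vcompA; congr (_ • _).
rewrite (vrea (assoc_natm _ _ _)) !vcompA; congr (_ • (_ • _)).
rewrite (vrea (pentagon_lr _ _ _ _)) !vcompA; congr (_ • _).
rewrite (vrea (assoc_natr _ _ _)) !vcompA (vrea4 (pentagon_inv _ _ _ _)).
rewrite (vrea (assoc_inv_natl _ _ _)) !vcompA.
rewrite (vrea (hcomp_rl _ _)) -hcomp_lr !vcompA.
rewrite (vrea (assoc_natl _ _ _)) !vcompA; congr (_ • _).
rewrite (vrea3 (eq_sym (pentagon _ _ _ _))) !vcompA; congr (_ • _).
rewrite (vrea (assoc_natr _ _ _)) !vcompA; congr (_ • _).
rewrite (vrea (eq_sym (pentagon_mid _ _ _ _))) !vcompA; congr (_ • (_ • _)).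
rewrite (vrea (assoc_inv_natm _ _ _)) !vcompA; congr (_ • _).
exact: pentagon_bot.
Qed.

Definition pseudonat_comp : pseudonat F H :=
  {| pn0 := fun a => t a ∘ s a;
     pn1 := pseudonat_comp1;
     pn1_inv := pseudonat_comp_inv;
     pn1_nat := pseudonat_comp_nat;
     pn1_unit := pseudonat_comp_unit;
     pn1_comp := pseudonat_comp_comp |}.

End Comp.

Definition modification_hcomp (F G H : pseudofunctor A B)
  (t t' : pseudonat G H) (s s' : pseudonat F G)
  (n : modification t t') (m : modification s s') :
  modification (pseudonat_comp t s) (pseudonat_comp t' s').
Proof.
refine (@Modification _ _ _ _ (pseudonat_comp t s) (pseudonat_comp t' s')
  (fun a => n a ∗ m a) _).
abstract by intros; rewrite /= /pseudonat_comp1 !vcompA assoc_nat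
  (vrea (eq_sym (hcomp_vcomp _ _ _ _))) vcomp1c md0_nat -[n b]vcompc1
  hcomp_vcomp !vcompA (vrea (assoc_inv_nat _ _ _)) !vcompA
  (vrea (eq_sym (hcomp_vcomp _ _ _ _))) vcomp1c md0_nat -[m a]vcompc1
  hcomp_vcomp vcompc1 !vcompA (vrea (assoc_nat _ _ _)) vcompA.
Defined.

Definition modification_inv (F G : pseudofunctor A B) (s t : pseudonat F G)
  (m : modification s t) (n : forall a, t a ⟹ s a)
  (mn : forall a, m a • n a = id2 (t a)) (nm : forall a, n a • m a = id2 (s a)) :
  modification t s.
Proof.
refine {| md0 := n |}.
abstract by move=> a b f;
  rewrite -[LHS]vcomp1c -hcomp_id2 -(nm a) whiskerl_vcomp !vcompA
  (vrea (eq_sym (md0_nat m f))) vcompA (whiskerrK _ (mn b)) vcompc1.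
Defined.

Definition hom_assoc (F G H K : pseudofunctor A B)
  (u : pseudonat H K) (t : pseudonat G H) (s : pseudonat F G) :
  modification (pseudonat_comp (pseudonat_comp u t) s)
               (pseudonat_comp u (pseudonat_comp t s)).
Proof.
refine (@Modification _ _ _ _ (pseudonat_comp (pseudonat_comp u t) s)
  (pseudonat_comp u (pseudonat_comp t s))
  (fun a => assoc (u a) (t a) (s a)) _).
abstract by intros; rewrite /= /pseudonat_comp1 !whiskerl_vcomp !whiskerr_vcomp
  !vcompA (vrea3 (eq_sym (pentagon _ _ _ _))) !vcompA
  (vrea (assoc_natr _ _ _)) !vcompA (vrea (pentagon_top _ _ _ _)) !vcompA
  (vrea (assoc_natm _ _ _)) !vcompA (vrea (pentagon_lr _ _ _ _)) !vcompA
  (vrea (assoc_invK _ _ _)) vcomp1c (vrea (assoc_natl _ _ _)) !vcompA pentagon.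
Defined.

Definition hom_lunit (F G : pseudofunctor A B) (s : pseudonat F G) :
  modification (pseudonat_comp (pseudonat_id G) s) s.
Proof.
refine (@Modification _ _ _ _ (pseudonat_comp (pseudonat_id G) s) s
  (fun a => lunit (s a)) _).
abstract by intros; rewrite /= /pseudonat_comp1 /= !whiskerr_vcomp !vcompA
  (vrea3 (unit_middle _ _)) vcomp1c (vrea (lunit_assoc_inv _ _))
  (vrea (lunit_nat _)) !vcompA lunit_comp.
Defined.

Definition hom_runit (F G : pseudofunctor A B) (s : pseudonat F G) :
  modification (pseudonat_comp s (pseudonat_id F)) s.
Proof.
refine (@Modification _ _ _ _ (pseudonat_comp s (pseudonat_id F)) s
  (fun a => runit (s a)) _).
abstract by intros; rewrite /= /pseudonat_comp1 /= !whiskerl_vcomp !vcompA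
  triangle (vrea (runit_comp _ _)) (vrea (runit_nat _)) !vcompA
  (vrea (assoc_inv_runit_inv _ _)) (vrea (runit_invK _)) vcomp1c.
Defined.

Definition hom_bicategory : bicategory.
Proof.
refine {|
  ob := pseudofunctor A B;
  hom := @pseudonat A B;
  cell := @modification A B;
  id1 := pseudonat_id;
  comp1 := pseudonat_comp;
  id2 := @modification_id A B;
  vcomp := @modification_vcomp A B;
  hcomp := modification_hcomp;
  assoc := hom_assoc;
  assoc_inv := fun F G H K u t s => modification_inv (m := hom_assoc u t s)
    (fun a => assoc_invK (u a) (t a) (s a))
    (fun a => assocK (u a) (t a) (s a));
  lunit := hom_lunit;
  lunit_inv := fun F G s => modification_inv (m := hom_lunit s)
    (fun a => lunit_invK (s a)) (fun a => lunitK (s a));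
  runit := hom_runit;
  runit_inv := fun F G s => modification_inv (m := hom_runit s)
    (fun a => runit_invK (s a)) (fun a => runitK (s a)) |};
abstract (intros; apply: modification_eq; intro; cbn;
  solve [ exact: vcompA | exact: vcomp1c | exact: vcompc1 | exact: hcomp_id2
  | exact: hcomp_vcomp | exact: assocK | exact: assoc_invK | exact: lunitK
  | exact: lunit_invK | exact: runitK | exact: runit_invK | exact: assoc_nat
  | exact: lunit_nat | exact: runit_nat | exact: pentagon | exact: triangle ]).
Defined.

End HomOps.

Section IdentityCells.
Variable A : bicategory.

Lemma eq_to_cell_id (a b : A) (f : hom a b) (e : f = f) :
  eq_to_cell e = id2 f.
Proof. by rewrite (proof_irrelevance _ e eq_refl). Qed.

Lemma is_identity_id2 (a b : A) (f : hom a b) : is_identity (id2 f).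
Proof. by exists eq_refl. Qed.

Lemma is_identity_vcomp (a b : A) (f g h : hom a b) (y : g ⟹ h) (x : f ⟹ g) :
  is_identity y -> is_identity x -> is_identity (y • x).
Proof.
by move=> [e ->] [e' ->]; clear y x; case: h / e; case: g / e'; exists eq_refl;
  rewrite vcomp1c.
Qed.

End IdentityCells.

Lemma is_identity_pf2 (A B : bicategory) (F : pseudofunctor A B) (a b : A)
  (f g : hom a b) (x : f ⟹ g) : is_identity x -> is_identity (pf2 F x).
Proof. by move=> [e ->]; clear x; case: g / e; exists eq_refl; rewrite pf2_id2. Qed.

Lemma modification_is_identity (A B : bicategory) (F G : pseudofunctor A B)
  (s t : pseudonat F G) (m : modification s t) :
  (forall a, is_identity (m a)) ->
  @is_identity (hom_bicategory A B) F G s t m.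
Proof.
case: s t m => [s s1 s2 s3 s4 s5] [t t1 t2 t3 t4 t5] [m mP].
cbn in m, mP |- * => me.
have e : s = t.
  by apply: functional_extensionality_dep => a; case: (me a).
case: t / e t1 t2 t3 t4 t5 m mP me => t1 t2 t3 t4 t5 m mP me.
have m1 a : m a = id2 (s a) by case: (me a) => e ->; exact: eq_to_cell_id.
have e1 : s1 = t1.
  do 3 (apply: functional_extensionality_dep; intro).
  by move: (mP _ _ x1); rewrite !m1 !hcomp_id2 vcomp1c vcompc1.
clear me; case: t1 / e1 t2 t3 t4 t5 mP => t2 t3 t4 t5.
rewrite -(proof_irrelevance _ s2 t2) -(proof_irrelevance _ s3 t3).
rewrite -(proof_irrelevance _ s4 t4) -(proof_irrelevance _ s5 t5) => mP.
exists eq_refl; exact: modification_eq.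
Qed.

Definition hom_2category (A : bicategory) (B : two_category) : two_category.
Proof.
refine (@TwoCategory (hom_bicategory A B) _).
abstract by case: B => B [sa sl sr]; split => *;
  apply: modification_is_identity => a; [exact: sa | exact: sl | exact: sr].
Defined.

(** A 2-functor is likewise a pseudofunctor whose constraints are identities,
    so that 2-functors form a subtype of the objects of [Hom(A,B)]. *)
Record is_strict_functor (A B : bicategory) (F : pseudofunctor A B) : Prop :=
  IsStrictFunctor {
  strict_unit : forall a : A, is_identity (pf_unit F a);
  strict_comp : forall (a b c : A) (g : hom b c) (f : hom a b),
    is_identity (pf_comp F g f)
}.

Record two_functor (A B : two_category) := TwoFunctor {
  two_pf :> pseudofunctor A B;
  two_functor_strict : is_strict_functor two_pf
}.

Definition two_functor_id (A : two_category) : two_functor A A.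
Proof.
refine (@TwoFunctor _ _ (pseudofunctor_id A) _).
abstract by split => * /=; exact: is_identity_id2.
Defined.

Definition two_functor_comp (A B C : two_category) (G : two_functor B C)
  (F : two_functor A B) : two_functor A C.
Proof.
refine (@TwoFunctor _ _ (pseudofunctor_comp G F) _).
abstract by case: G F => G [Gu Gc] [F [Fu Fc]]; split => * /=;
  apply: is_identity_vcomp => //; apply: is_identity_pf2.
Defined.

Definition is_isomorphism (A B : two_category) (F : two_functor A B) : Prop :=
  exists G : two_functor B A,
    two_functor_comp G F = two_functor_id A /\
    two_functor_comp F G = two_functor_id B.

Section FullSub.
Variables (A : two_category) (P : A -> Prop).

Definition full_sub_bicategory : bicategory.
Proof.
refine {|
  ob := {a : A | P a};
  hom := fun a b => hom (proj1_sig a) (proj1_sig b);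
  cell := fun a b f g => f ⟹ g;
  id1 := fun a => id1 (proj1_sig a);
  comp1 := fun a b c g f => g ∘ f;
  id2 := fun a b f => id2 f;
  vcomp := fun a b f g h y x => y • x;
  hcomp := fun a b c g g' f f' y x => y ∗ x;
  assoc := fun a b c d h g f => assoc h g f;
  assoc_inv := fun a b c d h g f => assoc_inv h g f;
  lunit := fun a b f => lunit f;
  lunit_inv := fun a b f => lunit_inv f;
  runit := fun a b f => runit f;
  runit_inv := fun a b f => runit_inv f |};
abstract (intros;
  solve [ exact: vcompA | exact: vcomp1c | exact: vcompc1 | exact: hcomp_id2
  | exact: hcomp_vcomp | exact: assocK | exact: assoc_invK | exact: lunitK
  | exact: lunit_invK | exact: runitK | exact: runit_invK | exact: assoc_nat
  | exact: lunit_nat | exact: runit_nat | exact: pentagon | exact: triangle ]).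
Defined.

Definition full_sub : two_category.
Proof.
refine (@TwoCategory full_sub_bicategory _).
abstract exact (IsStrict (A := full_sub_bicategory)
  (fun a b c d h g f => strict_assoc (two_strict A) h g f)
  (fun a b f => strict_lunit (two_strict A) f)
  (fun a b f => strict_runit (two_strict A) f)).
Defined.

Definition full_sub_incl : two_functor full_sub A.
Proof.
unshelve refine (@TwoFunctor full_sub A
  (@Pseudofunctor full_sub A (fun a => proj1_sig a) (fun a b f => f)
    (fun a b f g x => x) (fun a => id2 _) (fun a b c g f => id2 _)
    _ _ _ _ _ _ _ _) _);
abstract by first
  [ split => *; exact: is_identity_id2
  | intros; exact: invertible_id2
  | intros; cbn; rewrite ?hcomp_id2 ?vcomp1c ?vcompc1 ].
Defined.

End FullSub.

Definition ps_2category (A B : two_category) : two_category :=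
  @full_sub (hom_2category A B) (@is_strict_functor A B).

Definition ps_incl (A B : two_category) :
    two_functor (ps_2category A B) (hom_2category A B) :=
  @full_sub_incl (hom_2category A B) (@is_strict_functor A B).

Section Precomp.
Variables (A A' : bicategory) (T : pseudofunctor A A').

Section Cells.
Variables (B : bicategory) (F G : pseudofunctor A' B).

Definition pseudonat_precomp (s : pseudonat F G) :
  pseudonat (pseudofunctor_comp F T) (pseudofunctor_comp G T).
Proof.
refine (@Pseudonat _ _ (pseudofunctor_comp F T) (pseudofunctor_comp G T)
  (fun a => s (T a)) (fun a b f => pn1 s (pf1 T f)) _ _ _ _).
- abstract exact (fun a b f => pn1_inv s (pf1 T f)).
- abstract exact (fun a b f g x => pn1_nat s (pf2 T x)).
- abstract by intros; rewrite /= whiskerl_vcomp (vrea (pn1_nat _ _)) !vcompA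
    pn1_unit -vcompA -whiskerr_vcomp.
- abstract by intros; rewrite /= whiskerl_vcomp (vrea (pn1_nat _ _)) !vcompA
    pn1_comp -vcompA -whiskerr_vcomp.
Defined.

Definition modification_precomp (s t : pseudonat F G) (m : modification s t) :
  modification (pseudonat_precomp s) (pseudonat_precomp t).
Proof.
refine (@Modification _ _ _ _ (pseudonat_precomp s) (pseudonat_precomp t)
  (fun a => m (T a)) _).
abstract exact (fun a b f => md0_nat m (pf1 T f)).
Defined.

End Cells.

Definition pseudonat_precomp_id (B : bicategory) (F : pseudofunctor A' B) :
  modification (pseudonat_id (pseudofunctor_comp F T))
               (pseudonat_precomp (pseudonat_id F)).
Proof.
refine (@Modification _ _ _ _ (pseudonat_id (pseudofunctor_comp F T))
  (pseudonat_precomp (pseudonat_id F)) (fun a => id2 (id1 (F (T a)))) _).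
abstract by intros; rewrite /= !hcomp_id2 vcomp1c vcompc1.
Defined.

Definition pseudonat_precomp_comp (B : bicategory) (F G H : pseudofunctor A' B)
  (t : pseudonat G H) (s : pseudonat F G) :
  modification (pseudonat_comp (pseudonat_precomp t) (pseudonat_precomp s))
               (pseudonat_precomp (pseudonat_comp t s)).
Proof.
refine (@Modification _ _ _ _
  (pseudonat_comp (pseudonat_precomp t) (pseudonat_precomp s))
  (pseudonat_precomp (pseudonat_comp t s))
  (fun a => id2 (t (T a) ∘ s (T a))) _).
abstract by intros; rewrite /= !hcomp_id2 vcomp1c vcompc1.
Defined.

(** [Hom(T,1) : Hom(A',B) -> Hom(A,B)] *)
Definition hom_precomp (B : two_category) :
  two_functor (hom_2category A' B) (hom_2category A B).
Proof.
unshelve refine (@TwoFunctor (hom_2category A' B) (hom_2category A B)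
  (@Pseudofunctor (hom_2category A' B) (hom_2category A B)
    (fun F => pseudofunctor_comp F T)
    (fun F G s => pseudonat_precomp s)
    (fun F G s t m => modification_precomp m)
    (fun F => pseudonat_precomp_id F)
    (fun F G H t s => pseudonat_precomp_comp t s) _ _ _ _ _ _ _ _) _).
- abstract by move=> F; exists (modification_inv (m := pseudonat_precomp_id F)
    (fun a => vcomp1c (id2 _)) (fun a => vcomp1c (id2 _)));
    split; apply: modification_eq => a; exact: vcomp1c.
- abstract by move=> F G H t s;
    exists (modification_inv (m := pseudonat_precomp_comp t s)
    (fun a => vcomp1c (id2 _)) (fun a => vcomp1c (id2 _)));
    split; apply: modification_eq => a; exact: vcomp1c.
- abstract by intros; apply: modification_eq.
- abstract by intros; apply: modification_eq.
- abstract by intros; apply: modification_eq => ?; cbn;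
    rewrite vcomp1c vcompc1.
- abstract by intros; apply: modification_eq => ?; cbn;
    rewrite !hcomp_id2 !vcomp1c !vcompc1.
- abstract by intros; apply: modification_eq => ?; cbn;
    rewrite !hcomp_id2 !vcompc1.
- abstract by intros; apply: modification_eq => ?; cbn;
    rewrite !hcomp_id2 !vcompc1.
- abstract by split => *; apply: modification_is_identity => a;
    exact: is_identity_id2.
Defined.

End Precomp.

Section Strictification.
Variable A : bicategory.

(** Paths grow at their target end: [psnoc p f] is [(f_1,...,f_n,f)]
    where [p] is [(f_1,...,f_n)]. *)
Inductive path (a : A) : A -> Type :=
| pnil : path a a
| psnoc : forall b c, path a b -> hom b c -> path a c.

Arguments pnil {a}.
Arguments psnoc {a b c} _ _.

Definition unary (a b : A) (f : hom a b) : path a b := psnoc pnil f.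

(** [pcat p q] is [p] followed by [q]. *)
Fixpoint pcat (a b c : A) (p : path a b) (q : path b c) : path a c :=
  match q with
  | pnil => p
  | psnoc q f => psnoc (pcat p q) f
  end.

Lemma pcatA (a b c d : A) (p : path a b) (q : path b c) (r : path c d) :
  pcat p (pcat q r) = pcat (pcat p q) r.
Proof. by elim: r => //= ? ? r IH f; rewrite IH. Qed.

Lemma pcat_nil (a b : A) (q : path a b) : pcat pnil q = q.
Proof. by elim: q => //= ? ? q IH f; rewrite IH. Qed.

Definition eps_snoc (a b c : A) (p : path a b) :
    hom b c -> hom a b -> hom a c :=
  match p in path _ b return hom b c -> hom a b -> hom a c with
  | pnil => fun f _ => f
  | psnoc _ _ => fun f e => f ∘ e
  end.

Fixpoint eps (a b : A) (p : path a b) : hom a b :=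
  match p with
  | pnil => id1 a
  | psnoc q f => eps_snoc q f (eps q)
  end.

(** Since [eps (f)] is [f] rather than [f ∘ 1], the comparison of
    [eps (psnoc p f)] with [f ∘ eps p] is a unit constraint when [p] is empty
    and an identity otherwise. *)
Definition snoc_cell (a b c : A) (p : path a b) :
    forall f : hom b c, eps (psnoc p f) ⟹ f ∘ eps p :=
  match p in path _ b
    return forall f : hom b c, eps (psnoc p f) ⟹ f ∘ eps p with
  | pnil => fun f => runit_inv f
  | psnoc q g => fun f => id2 (f ∘ eps (psnoc q g))
  end.

Definition snoc_cell_inv (a b c : A) (p : path a b) :
    forall f : hom b c, f ∘ eps p ⟹ eps (psnoc p f) :=
  match p in path _ b
    return forall f : hom b c, f ∘ eps p ⟹ eps (psnoc p f) with
  | pnil => fun f => runit f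
  | psnoc q g => fun f => id2 (f ∘ eps (psnoc q g))
  end.

(** The canonical coherence isomorphism
    [eps q ∘ eps p ⟹ eps (pcat p q)] and its inverse *)
Fixpoint cat_cell (a b c : A) (p : path a b) (q : path b c) :
    eps q ∘ eps p ⟹ eps (pcat p q) :=
  match q in path _ c return eps q ∘ eps p ⟹ eps (pcat p q) with
  | pnil => lunit (eps p)
  | psnoc q f =>
      snoc_cell_inv (pcat p q) f • ((f ◁ cat_cell p q)
        • (assoc f (eps q) (eps p) • (snoc_cell q f ▷ eps p)))
  end.

Fixpoint cat_cell_inv (a b c : A) (p : path a b) (q : path b c) :
    eps (pcat p q) ⟹ eps q ∘ eps p :=
  match q in path _ c return eps (pcat p q) ⟹ eps q ∘ eps p with
  | pnil => lunit_inv (eps p)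
  | psnoc q f =>
      (snoc_cell_inv q f ▷ eps p) • (assoc_inv f (eps q) (eps p)
        • ((f ◁ cat_cell_inv p q) • snoc_cell (pcat p q) f))
  end.

Lemma snoc_cellK (a b c : A) (p : path a b) (f : hom b c) :
  snoc_cell_inv p f • snoc_cell p f = id2 _.
Proof. by case: p f => [f|? ? p g f] /=; rewrite ?runit_invK ?vcomp1c. Qed.

Lemma snoc_cell_invK (a b c : A) (p : path a b) (f : hom b c) :
  snoc_cell p f • snoc_cell_inv p f = id2 _.
Proof. by case: p f => [f|? ? p g f] /=; rewrite ?runitK ?vcomp1c. Qed.

Lemma cat_cellK (a b c : A) (p : path a b) (q : path b c) :
  cat_cell_inv p q • cat_cell p q = id2 _.
Proof.
elim: q => [|? ? q IH f]; rewrite [cat_cell _ _]/= [cat_cell_inv _ _]/=.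
  by rewrite lunitK.
rewrite !vcompA (vrea (snoc_cell_invK _ _)) vcomp1c (vrea (whiskerlK _ IH)).
by rewrite vcomp1c (vrea (assocK _ _ _)) vcomp1c (whiskerrK _ (snoc_cellK _ _)).
Qed.

Lemma cat_cell_invK (a b c : A) (p : path a b) (q : path b c) :
  cat_cell p q • cat_cell_inv p q = id2 _.
Proof.
elim: q => [|? ? q IH f]; rewrite [cat_cell _ _]/= [cat_cell_inv _ _]/=.
  by rewrite lunit_invK.
rewrite !vcompA (vrea (whiskerrK _ (snoc_cell_invK _ _))) vcomp1c.
rewrite (vrea (assoc_invK _ _ _)) vcomp1c (vrea (whiskerlK _ IH)).
by rewrite vcomp1c snoc_cellK.
Qed.

Lemma invertible_cat_cell (a b c : A) (p : path a b) (q : path b c) :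
  invertible (cat_cell p q).
Proof. by exists (cat_cell_inv p q); rewrite cat_cellK cat_cell_invK. Qed.

Definition path_cell (a b : A) (p q : path a b) (e : p = q) :
    eps p ⟹ eps q := eq_to_cell (f_equal (@eps a b) e).

Lemma path_cell_irr (a b : A) (p q : path a b) (e e' : p = q) :
  path_cell e = path_cell e'.
Proof. by rewrite (proof_irrelevance _ e e'). Qed.

Lemma path_cell_id (a b : A) (p : path a b) (e : p = p) :
  path_cell e = id2 (eps p).
Proof. exact: eq_to_cell_id. Qed.

Lemma path_cell_vcomp (a b : A) (p q r : path a b)
  (e : q = r) (e' : p = q) (e'' : p = r) :
  path_cell e • path_cell e' = path_cell e''.
Proof. by case: r / e e''; case: q / e' => e; rewrite !path_cell_id vcomp1c. Qed.

Lemma path_cell_snoc (a b c : A) (p q : path a b) (f : hom b c) (e : p = q)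
  (e' : psnoc p f = psnoc q f) :
  snoc_cell_inv q f • (f ◁ path_cell e) = path_cell e' • snoc_cell_inv p f.
Proof.
by case: q / e e' => e; rewrite !path_cell_id hcomp_id2 vcomp1c vcompc1.
Qed.

Lemma cat_cell_nil (a b : A) (q : path a b) :
  path_cell (pcat_nil q) • cat_cell pnil q = runit (eps q).
Proof.
elim: q => [|b' c q IH f].
  by rewrite path_cell_id vcomp1c [LHS]/= lunit_id1.
rewrite [cat_cell _ _]/= (vrea (eq_sym (path_cell_snoc (pcat_nil q) _))).
rewrite !vcompA (vrea (eq_sym (whiskerl_vcomp _ _ _))) IH.
by rewrite (vrea (runit_comp _ _)) runit_nat (vrea (snoc_cellK _ _)) vcomp1c.
Qed.

Lemma cat_cell_assoc (a b c d : A)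
  (p : path a b) (q : path b c) (r : path c d) :
  cat_cell (pcat p q) r
    • ((eps r ◁ cat_cell p q) • assoc (eps r) (eps q) (eps p))
  = path_cell (pcatA p q r)
    • (cat_cell p (pcat q r) • (cat_cell q r ▷ eps p)).
Proof.
elim: r => [|d' e r IH f].
  rewrite path_cell_id vcomp1c /= (vrea (lunit_nat _)) vcompA.
  by rewrite lunit_comp.
rewrite [cat_cell (pcat p q) _]/= [cat_cell p (pcat _ _)]/= [cat_cell q _]/=.
rewrite !whiskerr_vcomp !vcompA (vrea (whiskerrK _ (snoc_cell_invK _ _))).
rewrite vcomp1c (vrea (assoc_natm _ _ _)) !vcompA.
rewrite (vrea (eq_sym (path_cell_snoc (pcatA p q r) _))) vcompA.
rewrite 2!(vrea (eq_sym (whiskerl_vcomp _ _ _))) !vcompA -IH !whiskerl_vcomp !vcompA.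
congr (_ • (_ • _)).
rewrite (vrea (hcomp_rl _ _)) -hcomp_lr vcompA (vrea (assoc_natl _ _ _)) vcompA.
congr (_ • _).
by rewrite -assoc_natr (vrea (pentagon _ _ _ _)) !vcompA.
Qed.

Definition path_hcomp (a b c : A) (q q' : path b c) (p p' : path a b)
    (y : eps q ⟹ eps q') (x : eps p ⟹ eps p') :
    eps (pcat p q) ⟹ eps (pcat p' q') :=
  cat_cell p' q' • ((y ∗ x) • cat_cell_inv p q).

Lemma path_hcomp_id2 (a b c : A) (q : path b c) (p : path a b) :
  path_hcomp (id2 (eps q)) (id2 (eps p)) = id2 (eps (pcat p q)).
Proof. by rewrite /path_hcomp hcomp_id2 vcomp1c cat_cell_invK. Qed.

Lemma path_hcomp_vcomp (a b c : A) (q q' q'' : path b c) (p p' p'' : path a b)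
  (y' : eps q' ⟹ eps q'') (y : eps q ⟹ eps q')
  (x' : eps p' ⟹ eps p'') (x : eps p ⟹ eps p') :
  path_hcomp (y' • y) (x' • x) = path_hcomp y' x' • path_hcomp y x.
Proof.
by rewrite /path_hcomp hcomp_vcomp !vcompA (vrea (cat_cellK _ _)) vcomp1c.
Qed.

Lemma path_hcomp_assoc (a b c d : A)
  (r r' : path c d) (q q' : path b c) (p p' : path a b)
  (z : eps r ⟹ eps r') (y : eps q ⟹ eps q') (x : eps p ⟹ eps p') :
  path_cell (pcatA p' q' r') • path_hcomp (path_hcomp z y) x
  = path_hcomp z (path_hcomp y x) • path_cell (pcatA p q r).
Proof.
rewrite /path_hcomp.
apply: (@invertible_cancelr _ _ _ _ _ _
  (cat_cell p (pcat q r) • (cat_cell q r ▷ eps p))).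
  by apply: invertible_vcomp; [|apply: invertible_hcomp];
    first [exact: invertible_cat_cell | exact: invertible_id2].
rewrite !vcompA -cat_cell_assoc (vrea (cat_cellK _ _)) vcomp1c.
rewrite (vrea (cat_cellK _ _)) vcomp1c -hcomp_vcomp vcompc1 !vcompA cat_cellK.
rewrite vcompc1 (vrea (eq_sym (hcomp_vcomp _ _ _ _))) vcompc1 !vcompA cat_cellK.
rewrite vcompc1 -[x]vcomp1c hcomp_vcomp.
rewrite -[z in RHS]vcomp1c hcomp_vcomp vcomp1c !vcompA -assoc_nat.
by rewrite (vrea3 (cat_cell_assoc _ _ _)) !vcompA.
Qed.

Lemma path_hcomp_nil (a b : A) (p p' : path a b) (x : eps p ⟹ eps p') :
  path_hcomp (id2 (eps pnil)) x = x.
Proof.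
by rewrite /path_hcomp /= (vrea (lunit_nat _)) vcompA lunit_invK vcompc1.
Qed.

Lemma path_hcomp_nilr (a b : A) (q q' : path a b) (y : eps q ⟹ eps q') :
  path_cell (pcat_nil q') • path_hcomp y (id2 (eps pnil))
  = y • path_cell (pcat_nil q).
Proof.
apply: (@invertible_cancelr _ _ _ _ _ _ (cat_cell pnil q)).
  exact: invertible_cat_cell.
rewrite /path_hcomp !vcompA cat_cellK vcompc1 (vrea (cat_cell_nil _)).
by rewrite cat_cell_nil runit_nat.
Qed.

Lemma path_cellK (a b : A) (p q : path a b) (e : p = q) :
  path_cell (eq_sym e) • path_cell e = id2 _.
Proof. by rewrite (path_cell_vcomp _ _ eq_refl). Qed.

Lemma path_cell_invK (a b : A) (p q : path a b) (e : p = q) :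
  path_cell e • path_cell (eq_sym e) = id2 _.
Proof. by rewrite (path_cell_vcomp _ _ eq_refl). Qed.

Definition path_identity (a b : A) (p q : path a b) (x : eps p ⟹ eps q) :=
  exists e : p = q, x = path_cell e.

Lemma path_identity_eq (a b : A) (p q : path a b) (x y : eps p ⟹ eps q) :
  path_identity x -> path_identity y -> x = y.
Proof. by move=> [e ->] [e' ->]; exact: path_cell_irr. Qed.

Lemma path_identity_cell (a b : A) (p q : path a b) (e : p = q) :
  path_identity (path_cell e).
Proof. by exists e. Qed.

Lemma path_identity_id2 (a b : A) (p : path a b) :
  path_identity (id2 (eps p)).
Proof. by exists eq_refl. Qed.

Lemma path_identity_vcomp (a b : A) (p q r : path a b)
  (y : eps q ⟹ eps r) (x : eps p ⟹ eps q) :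
  path_identity y -> path_identity x -> path_identity (y • x).
Proof.
by move=> [e ->] [e' ->]; exists (eq_trans e' e); exact: path_cell_vcomp.
Qed.

Lemma path_identity_hcomp (a b c : A) (q q' : path b c) (p p' : path a b)
  (y : eps q ⟹ eps q') (x : eps p ⟹ eps p') :
  path_identity y -> path_identity x -> path_identity (path_hcomp y x).
Proof.
move=> [e ->] [e' ->]; clear y x; case: q' / e; case: p' / e'.
by exists eq_refl; exact: path_hcomp_id2.
Qed.

Local Ltac path_identity :=
  repeat first [ exact: path_identity_cell | exact: path_identity_id2
    | apply: path_identity_vcomp | apply: path_identity_hcomp ].

Definition st_bicategory : bicategory.
Proof.
unshelve refine {|
  ob := A;
  hom := path;
  cell := fun a b p q => eps p ⟹ eps q;
  id1 := @pnil;
  comp1 := fun a b c q p => pcat p q;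
  id2 := fun a b p => id2 (eps p);
  vcomp := fun a b p q r y x => y • x;
  hcomp := path_hcomp;
  assoc := fun a b c d r q p => path_cell (pcatA p q r);
  assoc_inv := fun a b c d r q p => path_cell (eq_sym (pcatA p q r));
  lunit := fun a b p => id2 (eps p);
  lunit_inv := fun a b p => id2 (eps p);
  runit := fun a b p => path_cell (pcat_nil p);
  runit_inv := fun a b p => path_cell (eq_sym (pcat_nil p)) |}.
- abstract by intros; exact: vcompA.
- abstract by intros; exact: vcomp1c.
- abstract by intros; exact: vcompc1.
- abstract by intros; exact: path_hcomp_id2.
- abstract by intros; exact: path_hcomp_vcomp.
- abstract by intros; exact: path_cellK.
- abstract by intros; exact: path_cell_invK.
- abstract by intros; exact: vcomp1c.
- abstract by intros; exact: vcomp1c.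
- abstract by intros; exact: path_cellK.
- abstract by intros; exact: path_cell_invK.
- abstract by intros; exact: path_hcomp_assoc.
- abstract by intros; rewrite /= path_hcomp_nil vcomp1c vcompc1.
- abstract by intros; exact: path_hcomp_nilr.
- abstract by intros; apply: path_identity_eq; path_identity.
- abstract by intros; apply: path_identity_eq; path_identity.
Defined.

Lemma st_eq_to_cell (a b : A) (p q : path a b) (e : p = q) :
  path_cell e = @eq_to_cell st_bicategory a b p q e.
Proof. by case: q / e. Qed.

Definition st : two_category.
Proof.
refine (@TwoCategory st_bicategory _).
abstract (split;
  [ move=> a b c d h g f; exists (pcatA f g h); exact: st_eq_to_cell
  | move=> a b f; exact: (is_identity_id2 (A := st_bicategory))
  | move=> a b f; exists (pcat_nil f); exact: st_eq_to_cell ]).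
Defined.

Lemma cat_cell_unary (a b c d : A) (g : hom c d) (p : path a b)
  (f : hom b c) :
  cat_cell (psnoc p f) (unary g) = id2 (g ∘ eps (psnoc p f)).
Proof. by rewrite [LHS]/= vcomp1c unit_middle. Qed.

Lemma cat_cell_inv_unary (a b c d : A) (g : hom c d) (p : path a b)
  (f : hom b c) :
  cat_cell_inv (psnoc p f) (unary g) = id2 (g ∘ eps (psnoc p f)).
Proof.
move: (cat_cellK (psnoc p f) (unary g)); rewrite cat_cell_unary => <-.
by rewrite [RHS]vcompc1.
Qed.

Lemma cat_cell_inv_unary2 (a b c d : A) (h : hom c d) (g : hom b c)
  (f : hom a b) :
  cat_cell_inv (unary f) (pcat (unary g) (unary h)) = assoc_inv h g f.
Proof.
rewrite [LHS]/= vcompc1 hcomp_id2 vcomp1c.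
move: (cat_cell_inv_unary g pnil f) => /= ->.
by rewrite hcomp_id2 vcompc1.
Qed.

Lemma cat_cell_inv_nil (a b : A) (f : hom a b) :
  cat_cell_inv pnil (unary f) = runit_inv f.
Proof.
apply: (invertible_cancelr (invertible_cat_cell pnil (unary f))).
rewrite cat_cellK -[cat_cell _ _]vcomp1c.
by rewrite -(path_cell_id (pcat_nil (unary f))) cat_cell_nil runitK.
Qed.

Lemma path_hcomp_unary (a b c : A) (g g' : hom b c) (f f' : hom a b)
  (y : g ⟹ g') (x : f ⟹ f') :
  @path_hcomp _ _ _ (unary g) (unary g') (unary f) (unary f') y x = y ∗ x.
Proof.
by rewrite /path_hcomp cat_cell_unary cat_cell_inv_unary vcomp1c vcompc1.
Qed.

(** The unit constraint [() ⟹ (1_a)] and composition constraint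
    [(f,g) ⟹ (g ∘ f)] are identity 2-cells of [A]. *)
Definition eta : pseudofunctor A st.
Proof.
unshelve refine (@Pseudofunctor A st (fun a => a) unary
  (fun a b f g x => x) (fun a => id2 (id1 a)) (fun a b c g f => id2 (g ∘ f))
  _ _ _ _ _ _ _ _).
- abstract by move=> a; exists (id2 (id1 a)); split; exact: vcomp1c.
- abstract by move=> a b c g f; exists (id2 (g ∘ f)); split; exact: vcomp1c.
- abstract by [].
- abstract by [].
- abstract by move=> a b c g g' f f' y x;
    rewrite [RHS]/= vcomp1c path_hcomp_unary; exact: vcompc1.
- abstract by move=> a b c d h g f; 
    rewrite /= vcomp1c [in RHS]path_cell_id vcomp1c vcompc1 /path_hcomp
      cat_cell_unary cat_cell_unary cat_cell_inv_unary cat_cell_inv_unary2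
      !hcomp_id2 !vcomp1c assoc_invK.
- abstract by move=> a b f;
    rewrite /= vcomp1c /path_hcomp cat_cell_unary hcomp_id2 !vcomp1c;
    exact: lunit_invK.
- abstract by move=> a b f;
    rewrite /= vcomp1c /path_hcomp cat_cell_unary cat_cell_inv_nil hcomp_id2
      !vcomp1c runit_invK path_cell_id.
Defined.

End Strictification.

Arguments pnil {A a}.
Arguments psnoc {A a b c} _ _.

(* Main.v *)
From Stdlib Require Import ssreflect FunctionalExtensionality ProofIrrelevance.
From Stdlib Require Import ClassicalEpsilon.
Require Import Defs.

(** A path [p] in a bicategory [A] is isomorphic, in the strictification
    [st A], to the unary path on its composite [eps p]: the identity 2-cell of
    [eps p] in [A] is such an isomorphism, here called [theta p]. It is built
    from the values and constraints of [eta A] alone, by [theta_nil] and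
    [theta_cat], and it is an identity when [p] is already unary. So anything natural on [st A]
    is forced by its restriction along [eta A], and conversely extends from it
    by conjugating with [theta].

    The proof checks that the 2-functor is bijective at each of the three
    levels, which is enough by [bijective_is_isomorphism].

    - On 2-cells: a modification of restricted transformations satisfies its
      axiom at unary paths, hence at every [p] by conjugation with [theta p]
      ([modification_precomp_bijective]).
    - On 1-cells: naturality at [theta p] shows that the component of a
      pseudonatural transformation at [p] is its component at [eps p]
      conjugated by [theta p] ([pn1_theta]). Taken as a definition, this
      formula extends any transformation of restrictions, and it gives back
      exactly the original one since [theta] is trivial on unary paths
      ([pseudonat_precomp_bijective]).
    - On objects: given a pseudofunctor [H] from [A] to a 2-category, a strict
      extension must send a path to the composite of the values of [H] on its
      entries, and must send [theta p] to the comparison [kappa p] from that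
      composite to [H (eps p)] built from the constraints of [H]. This
      determines it on 2-cells ([extend_functor_restriction]). Defining 2-cells
      by conjugation with [kappa] does give a 2-functor, because [kappa] is
      compatible with concatenation ([kappa_cat]), and it restricts to [H]
      because [kappa] is an identity on unary paths
      ([extend_functor_precomp]).

    Equations between functors and transformations only hold up to equality of
    their boundaries, so 2-cells are compared with the heterogeneous equality
    [heq2]; two pseudofunctors are equal as soon as they agree, in this sense,
    on 2-cells and on constraints ([pseudofunctor_eq]). *)

Set Implicit Arguments.
Unset Strict Implicit.
Unset Printing Implicit Defensive.

Local Notation inj_pair2 := ProofIrrelevanceTheory.EqdepTheory.inj_pair2.

Reserved Notation "x ≈ y" (at level 70).

(** * Heterogeneous equality of 2-cells *)

(** Equality of 2-cells together with their boundary 1-cells and objects. *)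
Inductive heq2 (A : bicategory) (a b : A) (f g : hom a b) (x : f ⟹ g) :
    forall (a' b' : A) (f' g' : hom a' b'), f' ⟹ g' -> Prop :=
| heq2_refl : heq2 x x.

Notation "x ≈ y" := (heq2 x y) : bicat_scope.

#[local] Hint Resolve heq2_refl : core.

Section HeqTheory.
Variable A : bicategory.
Implicit Types a b c : A.

Lemma heq2_sym a b (f g : hom a b) (x : f ⟹ g) a' b' (f' g' : hom a' b')
  (x' : f' ⟹ g') : x ≈ x' -> x' ≈ x.
Proof. by case. Qed.

Lemma heq2_trans a b (f g : hom a b) (x : f ⟹ g)
  a' b' (f' g' : hom a' b') (x' : f' ⟹ g')
  a'' b'' (f'' g'' : hom a'' b'') (x'' : f'' ⟹ g'') :
  x ≈ x' -> x' ≈ x'' -> x ≈ x''.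
Proof. by case. Qed.

Lemma heq2_of_eq a b (f g : hom a b) (x y : f ⟹ g) : x = y -> x ≈ y.
Proof. by move=> ->. Qed.

Lemma heq2_ends a b (f g : hom a b) (x : f ⟹ g) a' b' (f' g' : hom a' b')
  (x' : f' ⟹ g') : x ≈ x' -> a = a' /\ b = b'.
Proof. by case. Qed.

Lemma heq2_bounds a b (f g f' g' : hom a b) (x : f ⟹ g) (x' : f' ⟹ g') :
  x ≈ x' -> f = f' /\ g = g'.
Proof.
pose T (a b : A) (f : hom a b) :=
  existT (fun a => {b & hom a b}) a (existT _ b f).
have gen a' b' (h k : hom a' b') (y : h ⟹ k) :
  x ≈ y -> T _ _ f = T _ _ h /\ T _ _ g = T _ _ k by case.
move=> /gen [ef eg].
by split; apply: inj_pair2; [exact: inj_pair2 ef | exact: inj_pair2 eg].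
Qed.

Lemma heq2_eq a b (f g : hom a b) (x y : f ⟹ g) : x ≈ y -> x = y.
Proof.
pose T (a b : A) (f g : hom a b) (x : f ⟹ g) :=
  existT (fun a => {b & {f : hom a b & {g : hom a b & f ⟹ g}}}) a
    (existT _ b (existT _ f (existT _ g x))).
have gen a' b' (h k : hom a' b') (z : h ⟹ k) : 
  x ≈ z -> T _ _ _ _ x = T _ _ _ _ z by case.
by move=> /gen e; do 4 apply inj_pair2 in e.
Qed.

Lemma heq2_vcomp a b (f g h : hom a b) (y : g ⟹ h) (x : f ⟹ g)
  a' b' (f' g' h' : hom a' b') (y' : g' ⟹ h') (x' : f' ⟹ g') :
  y ≈ y' -> x ≈ x' -> y • x ≈ y' • x'.
Proof.
move=> hy hx; case: hx h' y' hy => h' y' hy.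
case: (heq2_bounds hy) => _ e; case: h' / e y' hy => y' hy.
by rewrite (heq2_eq hy).
Qed.

Lemma heq2_hcomp a b c (g g' : hom b c) (f f' : hom a b)
  (y : g ⟹ g') (x : f ⟹ f')
  a1 b1 c1 (g1 g1' : hom b1 c1) (f1 f1' : hom a1 b1)
  (y1 : g1 ⟹ g1') (x1 : f1 ⟹ f1') :
  y ≈ y1 -> x ≈ x1 -> y ∗ x ≈ y1 ∗ x1.
Proof.
move=> hy hx; case: hx g1 g1' y1 hy => g1 g1' y1 hy.
case: (heq2_ends hy) => _ e; case: c1 / e g1 g1' y1 hy => g1 g1' y1 hy.
case: (heq2_bounds hy) => e e'.
case: g1 / e y1 hy => y1; case: g1' / e' y1 => y1 hy.
by rewrite (heq2_eq hy).
Qed.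

Lemma heq2_id2 a b (f g : hom a b) : f = g -> id2 f ≈ id2 g.
Proof. by move=> ->. Qed.

Lemma heq2_identity a b (f g : hom a b) (x : f ⟹ g) :
  is_identity x -> x ≈ id2 f.
Proof. by move=> [e ->] {x}; case: g / e. Qed.

Lemma identity_heq2 a b (f g h : hom a b) (x : f ⟹ g) :
  x ≈ id2 h -> is_identity x.
Proof.
move=> e; case: (heq2_bounds e) => ef eg.
subst.
by rewrite (heq2_eq e); exact: is_identity_id2.
Qed.

Lemma identity_eq a b (f g : hom a b) (x y : f ⟹ g) :
  is_identity x -> is_identity y -> x = y.
Proof. by move=> [e ->] [e' ->]; rewrite (proof_irrelevance _ e e'). Qed.

Lemma is_identity_hcomp a b c (g g' : hom b c) (f f' : hom a b)
  (y : g ⟹ g') (x : f ⟹ f') :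
  is_identity y -> is_identity x -> is_identity (y ∗ x).
Proof.
move=> /heq2_identity hy /heq2_identity hx.
by apply: (identity_heq2 (h := g ∘ f)); rewrite -hcomp_id2; exact: heq2_hcomp.
Qed.

Lemma heq2_idl a b (f g h : hom a b) (y : g ⟹ h) (x : f ⟹ g) :
  is_identity y -> y • x ≈ x.
Proof. by move=> [e ey]; subst; rewrite vcomp1c. Qed.

Lemma heq2_idr a b (f g h : hom a b) (y : g ⟹ h) (x : f ⟹ g) :
  is_identity x -> y • x ≈ y.
Proof. by move=> [e ex]; subst; rewrite vcompc1. Qed.

(** Invertibility is a mere existence statement, but a functor out of [st A]
    needs the inverse as data. *)
Definition inv2 a b (f g : hom a b) (x : f ⟹ g) (i : invertible x) :
    g ⟹ f :=
  proj1_sig (constructive_indefinite_description _ i).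

Lemma inv2K a b (f g : hom a b) (x : f ⟹ g) (i : invertible x) :
  inv2 i • x = id2 f.
Proof. by rewrite /inv2; case: constructive_indefinite_description => ? []. Qed.

Lemma inv2_K a b (f g : hom a b) (x : f ⟹ g) (i : invertible x) :
  x • inv2 i = id2 g.
Proof. by rewrite /inv2; case: constructive_indefinite_description => ? []. Qed.

Lemma heq2_inverse a b (f g : hom a b) (x : f ⟹ g) (y : g ⟹ f)
  a' b' (f' g' : hom a' b') (x' : f' ⟹ g') (y' : g' ⟹ f') :
  y • x = id2 f -> x' • y' = id2 g' -> x ≈ x' -> y ≈ y'.
Proof.
move=> yx xy e; case: e y' xy => y' xy.
by rewrite -[y]vcompc1 -xy -vcompA yx vcomp1c.
Qed.

Lemma is_identity_inverse a b (f g : hom a b) (x : f ⟹ g) (y : g ⟹ f) :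
  y • x = id2 f -> is_identity x -> is_identity y.
Proof.
by move=> yx [e ex]; subst; rewrite -[y]vcompc1 yx; exact: is_identity_id2.
Qed.

End HeqTheory.

(** * Extensionality of functors and transformations *)

(** Agreement on identity 2-cells already gives agreement on 1-cells, and on
    objects through the identities of identities. *)
Lemma pseudofunctor_eq (A B : bicategory) (F G : pseudofunctor A B) :
  (forall (a b : A) (f g : hom a b) (x : f ⟹ g), pf2 F x ≈ pf2 G x) ->
  (forall a, pf_unit F a ≈ pf_unit G a) ->
  (forall (a b c : A) (g : hom b c) (f : hom a b),
    pf_comp F g f ≈ pf_comp G g f) ->
  F = G.
Proof.
case: F G => F0 F1 F2 Fu Fc p1 p2 p3 p4 p5 p6 p7 p8.
case=> G0 G1 G2 Gu Gc q1 q2 q3 q4 q5 q6 q7 q8 /= e2 eu ec.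
have e0 : F0 = G0.
  apply: functional_extensionality_dep => a.
  by case: (heq2_ends (e2 a a _ _ (id2 (id1 a)))).
case: G0 / e0 G1 G2 Gu Gc q1 q2 q3 q4 q5 q6 q7 q8 e2 eu ec
  => G1 G2 Gu Gc q1 q2 q3 q4 q5 q6 q7 q8 e2 eu ec.
have e1 : F1 = G1.
  do 3 (apply: functional_extensionality_dep; intro).
  by case: (heq2_bounds (e2 _ _ _ _ (id2 x1))).
case: G1 / e1 G2 Gu Gc q1 q2 q3 q4 q5 q6 q7 q8 e2 eu ec
  => G2 Gu Gc q1 q2 q3 q4 q5 q6 q7 q8 e2 eu ec.
have {}e2 : F2 = G2.
  do 5 (apply: functional_extensionality_dep; intro); exact: heq2_eq.
have {}eu : Fu = Gu.
  by apply: functional_extensionality_dep => a; exact: heq2_eq.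
have {}ec : Fc = Gc.
  do 5 (apply: functional_extensionality_dep; intro); exact: heq2_eq.
subst; f_equal; exact: proof_irrelevance.
Qed.

Lemma pseudonat_eq (A B : bicategory) (F G : pseudofunctor A B)
  (s t : pseudonat F G) :
  (forall a, s a = t a) ->
  (forall (a b : A) (f : hom a b), pn1 s f ≈ pn1 t f) -> s = t.
Proof.
case: s t => s0 s1 p1 p2 p3 p4 [t0 t1 q1 q2 q3 q4] /= e0 e1.
have {}e0 : s0 = t0 by exact: functional_extensionality_dep.
case: t0 / e0 t1 q1 q2 q3 q4 e1 => t1 q1 q2 q3 q4 e1.
have {}e1 : s1 = t1.
  do 3 (apply: functional_extensionality_dep; intro); exact: heq2_eq.
subst; f_equal; exact: proof_irrelevance.
Qed.

Lemma heq2_pn1 (A B : bicategory) (F G : pseudofunctor A B)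
  (s t : pseudonat F G) (a b : A) (f : hom a b) (e : s = t) :
  pn1 s f ≈ pn1 t f.
Proof. by rewrite e. Qed.

(** The constraints of strict functors are identities, so they agree as soon
    as their boundaries do. *)
Lemma strict_functor_eq (A B : bicategory) (F G : pseudofunctor A B) :
  is_strict_functor F -> is_strict_functor G ->
  (forall (a b : A) (f g : hom a b) (x : f ⟹ g), pf2 F x ≈ pf2 G x) ->
  F = G.
Proof.
move=> [Fu Fc] [Gu Gc] e.
have e1 (a b : A) (f : hom a b) : id2 (pf1 F f) ≈ id2 (pf1 G f).
  by rewrite -!pf2_id2.
apply: pseudofunctor_eq => // [a|a b c g f].
  apply: heq2_trans (heq2_identity (Fu a)) _.
  apply: heq2_trans (heq2_sym (heq2_identity (Gu a))).
  by case: (heq2_ends (e1 _ _ (id1 a))) => ->.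
apply: heq2_trans (heq2_identity (Fc _ _ _ g f)) _.
apply: heq2_trans (heq2_sym (heq2_identity (Gc _ _ _ g f))).
by rewrite -!hcomp_id2; exact: heq2_hcomp.
Qed.

Lemma two_functor_eq (A B : two_category) (F G : two_functor A B) :
  (forall (a b : A) (f g : hom a b) (x : f ⟹ g), pf2 F x ≈ pf2 G x) ->
  F = G.
Proof.
case: F G => F sF [G sG] /= /(strict_functor_eq sF sG) e.
by subst; congr TwoFunctor; exact: proof_irrelevance.
Qed.

(** Naturality of the composition constraint, which is an identity. *)
Lemma strict_pf2_hcomp (A B : bicategory) (F : pseudofunctor A B) :
  is_strict_functor F ->
  forall (a b c : A) (g g' : hom b c) (f f' : hom a b)
    (y : g ⟹ g') (x : f ⟹ f'), pf2 F (y ∗ x) ≈ pf2 F y ∗ pf2 F x.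
Proof.
move=> [_ Fc] a b c g g' f f' y x.
apply: heq2_trans (heq2_sym (heq2_idr _ (Fc _ _ _ g f))) _.
by rewrite pf_comp_nat; exact: heq2_idl.
Qed.

Lemma strict_id1 (A B : bicategory) (F : pseudofunctor A B) :
  is_strict_functor F -> forall a, id1 (F a) = pf1 F (id1 a).
Proof. by move=> [Fu _] a; case: (Fu a). Qed.

Lemma strict_comp1 (A B : bicategory) (F : pseudofunctor A B) :
  is_strict_functor F -> forall (a b c : A) (g : hom b c) (f : hom a b),
  pf1 F g ∘ pf1 F f = pf1 F (g ∘ f).
Proof. by move=> [_ Fc] a b c g f; case: (Fc a b c g f). Qed.

(** A 2-functor can be given by its action on cells alone: the coherence axioms
    of a pseudofunctor then compare parallel identity 2-cells, and those are
    equal by proof irrelevance. *)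
Section StrictBuilder.
Variables (A B : two_category) (F0 : A -> B).
Variable F1 : forall a b : A, hom a b -> hom (F0 a) (F0 b).
Variable F2 : forall (a b : A) (f g : hom a b), f ⟹ g -> F1 f ⟹ F1 g.
Hypothesis F1_id1 : forall a : A, id1 (F0 a) = F1 (id1 a).
Hypothesis F1_comp1 : forall (a b c : A) (g : hom b c) (f : hom a b),
  F1 g ∘ F1 f = F1 (g ∘ f).
Hypothesis F2_id2 : forall (a b : A) (f : hom a b), F2 (id2 f) = id2 (F1 f).
Hypothesis F2_vcomp : forall (a b : A) (f g h : hom a b)
  (y : g ⟹ h) (x : f ⟹ g), F2 (y • x) = F2 y • F2 x.
Hypothesis F2_hcomp : forall (a b c : A) (g g' : hom b c) (f f' : hom a b)
  (y : g ⟹ g') (x : f ⟹ f'), F2 (y ∗ x) ≈ F2 y ∗ F2 x.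

Lemma strict_identity (a b : A) (f g : hom a b) (x : f ⟹ g) :
  is_identity x -> is_identity (F2 x).
Proof.
by move=> [e ex]; subst; rewrite /= F2_id2; exact: is_identity_id2.
Qed.

Local Ltac identities := repeat first
  [ exact: is_identity_id2 | apply: is_identity_vcomp | apply: is_identity_hcomp
  | apply: strict_identity
  | apply: (strict_assoc (two_strict A)) | apply: (strict_assoc (two_strict B))
  | apply: (strict_lunit (two_strict A)) | apply: (strict_lunit (two_strict B))
  | apply: (strict_runit (two_strict A)) | apply: (strict_runit (two_strict B))
  | by eexists ].

Definition strict_functor_of : two_functor A B.
Proof.
unshelve refine (@TwoFunctor A B (@Pseudofunctor A B F0 F1 F2
  (fun a => eq_to_cell (F1_id1 a))
  (fun a b c g f => eq_to_cell (F1_comp1 g f)) _ _ _ _ _ _ _ _) _).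
- abstract by move=> a; case: _ / (F1_id1 a); exact: invertible_id2.
- abstract by move=> a b c g f; case: _ / (F1_comp1 g f); exact: invertible_id2.
- abstract by [].
- abstract by [].
- abstract (move=> a b c g g' f f' y x; apply: heq2_eq;
    apply: heq2_trans (heq2_idr _ _) _; [by eexists|];
    apply: heq2_trans (F2_hcomp _ _) _; apply: heq2_sym;
    by apply: heq2_idl; eexists).
- abstract by intros; apply: identity_eq; identities.
- abstract by intros; apply: identity_eq; identities.
- abstract by intros; apply: identity_eq; identities.
- abstract by split => *; eexists.
Defined.

End StrictBuilder.

(** * Bijective 2-functors are isomorphisms *)

Definition bijective (X Y : Type) (f : X -> Y) := forall y, exists! x, f x = y.

Lemma bijective_inj (X Y : Type) (f : X -> Y) : bijective f ->
  forall x y, f x = f y -> x = y.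
Proof.
by move=> bf x y e; case: (bf (f y)) => z [_ u]; rewrite -(u x e) (u y).
Qed.

Section BijectiveOnCells.
Variables (A B : two_category) (F : two_functor A B).
Hypothesis F0_bij : bijective (pf0 F).
Hypothesis F1_bij : forall a b : A, bijective (@pf1 _ _ F a b).
Hypothesis F2_bij : forall (a b : A) (f g : hom a b),
  bijective (@pf2 _ _ F a b f g).

Lemma ob_lift (b : B) : {a : A | F a = b}.
Proof.
apply: constructive_indefinite_description.
by case: (F0_bij b) => a [e _]; exists a.
Qed.

(** The ends [F a] and [b] are only propositionally equal; leaving [a] and [b]
    arbitrary lets that equality be eliminated, which would be impossible for
    [a] the chosen preimage of [b]. *)
Lemma hom_lift (a a' : A) (b b' : B) (h : hom b b') : F a = b -> F a' = b' ->
  {f : hom a a' | id2 (pf1 F f) ≈ id2 h}.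
Proof.
move=> ea ea'; apply: constructive_indefinite_description.
case: b / ea h; case: b' / ea' => h.
by case: (F1_bij h) => f [<- _]; exists f.
Qed.

Lemma cell_lift (a a' : A) (f g : hom a a') (b b' : B) (h k : hom b b')
  (y : h ⟹ k) : id2 (pf1 F f) ≈ id2 h -> id2 (pf1 F g) ≈ id2 k ->
  {x : f ⟹ g | pf2 F x ≈ y}.
Proof.
move=> ef eg; apply: constructive_indefinite_description.
case: (heq2_ends ef) => ea ea'.
case: b / ea h k y ef eg => h k; case: b' / ea' h k => h k y.
move=> /heq2_bounds [e _] /heq2_bounds [e' _].
case: h / e y; case: k / e' => y.
by case: (F2_bij y) => x [<- _]; exists x.
Qed.

Lemma hom_inj (a b : A) (f g : hom a b) :
  id2 (pf1 F f) ≈ id2 (pf1 F g) -> f = g.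
Proof. by move=> /heq2_bounds [/(bijective_inj (@F1_bij _ _))]. Qed.

Lemma cell_inj (a b a' b' : A) (f g : hom a b) (f' g' : hom a' b')
  (x : f ⟹ g) (y : f' ⟹ g') : pf2 F x ≈ pf2 F y -> x ≈ y.
Proof.
move=> e; case: (heq2_ends e) => ea eb.
move/(bijective_inj F0_bij): ea => ea; move/(bijective_inj F0_bij): eb => eb.
subst a' b'; case: (heq2_bounds e) => ef eg.
move/(bijective_inj (@F1_bij _ _)): ef => ef.
move/(bijective_inj (@F1_bij _ _)): eg => eg; subst f' g'.
by move: e => /heq2_eq /(bijective_inj (@F2_bij _ _ _ _)) ->.
Qed.

Let G0 b := proj1_sig (ob_lift b).
Let F0K b : F (G0 b) = b := proj2_sig (ob_lift b).
Let G1 b b' (h : hom b b') := proj1_sig (hom_lift h (F0K b) (F0K b')).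
Let F1K b b' (h : hom b b') : id2 (pf1 F (G1 h)) ≈ id2 h :=
  proj2_sig (hom_lift h (F0K b) (F0K b')).
Let G2 b b' (h k : hom b b') (y : h ⟹ k) :=
  proj1_sig (cell_lift y (F1K h) (F1K k)).
Let F2K b b' (h k : hom b b') (y : h ⟹ k) : pf2 F (G2 y) ≈ y :=
  proj2_sig (cell_lift y (F1K h) (F1K k)).

Lemma lift_id1 b : id1 (G0 b) = G1 (id1 b).
Proof.
apply: hom_inj; apply: heq2_trans (heq2_sym (F1K _)).
by rewrite -(strict_id1 (two_functor_strict F)) F0K.
Qed.

Lemma lift_comp1 a b c (k : hom b c) (h : hom a b) :
  G1 k ∘ G1 h = G1 (k ∘ h).
Proof.
apply: hom_inj; apply: heq2_trans (heq2_sym (F1K _)).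
rewrite -(strict_comp1 (two_functor_strict F)) -!hcomp_id2.
by apply: heq2_hcomp; exact: F1K.
Qed.

Lemma lift_id2 a b (h : hom a b) : G2 (id2 h) = id2 (G1 h).
Proof.
apply: heq2_eq; apply: cell_inj; apply: heq2_trans (F2K _) _.
by rewrite pf2_id2; apply: heq2_sym; exact: F1K.
Qed.

Lemma lift_vcomp a b (h k l : hom a b) (y : k ⟹ l) (x : h ⟹ k) :
  G2 (y • x) = G2 y • G2 x.
Proof.
apply: heq2_eq; apply: cell_inj; apply: heq2_trans (F2K _) _.
by rewrite pf2_vcomp; apply: heq2_sym; apply: heq2_vcomp; exact: F2K.
Qed.

Lemma lift_hcomp a b c (k k' : hom b c) (h h' : hom a b)
  (y : k ⟹ k') (x : h ⟹ h') : G2 (y ∗ x) ≈ G2 y ∗ G2 x.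
Proof.
apply: cell_inj.
apply: heq2_trans (F2K _) _; apply: heq2_sym.
apply: heq2_trans (strict_pf2_hcomp (two_functor_strict F) _ _) _.
by apply: heq2_hcomp; exact: F2K.
Qed.

(** The inverse sends a cell to its unique preimage. It preserves every
    operation because [F] does and [F] is injective up to [heq2]. *)
Theorem bijective_is_isomorphism : is_isomorphism F.
Proof.
exists (strict_functor_of lift_id1 lift_comp1 lift_id2 lift_vcomp lift_hcomp).
split; apply: two_functor_eq => a b f g x /=; last exact: F2K.
by apply: cell_inj; exact: F2K.
Qed.

End BijectiveOnCells.

(** * Every path is isomorphic to a unary path *)

Section Theta.
Variable A : bicategory.
Local Notation stA := (st A).

(** The values and constraints of [eta A] are retyped as 2-cells between paths
    of [st A], so that statements about functors on [st A] do not mention the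
    composite with [eta A]. *)
Definition eta2 (a b : A) (f g : hom a b) (x : f ⟹ g) :
  @cell stA a b (unary f) (unary g) := pf2 (eta A) x.

Definition eta_unit (a : A) : @cell stA a a (@id1 stA a) (unary (@id1 A a)) :=
  pf_unit (eta A) a.

Definition eta_comp (a b c : A) (g : hom b c) (f : hom a b) :
    @cell stA a c (@comp1 stA a b c (unary g) (unary f)) (unary (g ∘ f)) :=
  pf_comp (eta A) g f.

(** A 2-cell [p ⟹ q] of [st A] is a 2-cell [eps p ⟹ eps q] of [A], and
    [eps (unary f)] is [f]. *)
Definition theta (a b : stA) (p : hom a b) : p ⟹ unary (eps p) :=
  id2 (eps p).

Definition theta_inv (a b : stA) (p : hom a b) :
    @cell stA a b (unary (eps p)) p := id2 (eps p).

Lemma thetaK (a b : stA) (p : hom a b) : theta_inv p • theta p = id2 p.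
Proof. exact: vcomp1c. Qed.

Lemma theta_invK (a b : stA) (p : hom a b) : theta p • theta_inv p = id2 _.
Proof. exact: vcomp1c. Qed.

Lemma theta_nat (a b : stA) (p q : hom a b) (x : p ⟹ q) :
  theta q • x = eta2 (x : eps p ⟹ eps q) • theta p.
Proof. exact: eq_trans (vcomp1c _) (eq_sym (vcompc1 _)). Qed.

Lemma theta_unary (a b : A) (f : hom a b) :
  theta (unary f : @hom stA a b) = id2 (unary f : @hom stA a b).
Proof. by []. Qed.

Lemma theta_inv_unary (a b : A) (f : hom a b) :
  theta_inv (unary f : @hom stA a b) = id2 (unary f : @hom stA a b).
Proof. by []. Qed.

Lemma theta_nil (a : stA) : theta (id1 a) = eta_unit a.
Proof. by []. Qed.

(** Horizontal composition in [st A] conjugates by [cat_cell]; on the target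
    side, where both paths are unary, [cat_cell] is an identity, so
    [theta q ∗ theta p] is the inverse of [cat_cell p q]. *)
Lemma theta_cat (a b c : stA) (p : hom a b) (q : hom b c) :
  theta (q ∘ p) = eta2 (cat_cell p q)
    • (eta_comp (eps q) (eps p) • (theta q ∗ theta p)).
Proof.
have e : @vcomp A _ _ _ _ _ (cat_cell p q)
    (@vcomp A _ _ _ _ _ (id2 (eps q ∘ eps p))
      (@path_hcomp A _ _ _ q (unary (eps q)) p (unary (eps p))
        (id2 (eps q)) (id2 (eps p)))) = id2 (eps (pcat p q)).
  rewrite vcomp1c /path_hcomp cat_cell_unary !hcomp_id2 !vcomp1c.
  exact: cat_cell_invK.
exact: eq_sym e.
Qed.

Section Functor.
Variables (B : bicategory) (H : pseudofunctor stA B).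

Lemma pf_thetaK (a b : stA) (p : hom a b) :
  pf2 H (theta_inv p) • pf2 H (theta p) = id2 (pf1 H p).
Proof. by rewrite -pf2_vcomp thetaK pf2_id2. Qed.

Lemma pf_theta_invK (a b : stA) (p : hom a b) :
  pf2 H (theta p) • pf2 H (theta_inv p) = id2 (pf1 H (unary (eps p))).
Proof. by rewrite -pf2_vcomp theta_invK pf2_id2. Qed.

Lemma pf_theta_nat (a b : stA) (p q : hom a b) (x : p ⟹ q) :
  pf2 H (theta q) • pf2 H x
  = pf2 H (eta2 (x : eps p ⟹ eps q)) • pf2 H (theta p).
Proof. by rewrite -!pf2_vcomp theta_nat. Qed.

Lemma pf_theta_cat (a b c : stA) (p : hom a b) (q : hom b c) :
  pf2 H (theta (q ∘ p)) • pf_comp H q p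
  = pf2 H (eta2 (cat_cell p q))
    • (pf2 H (eta_comp (eps q) (eps p))
    • (pf_comp H (unary (eps q)) (unary (eps p))
    • (pf2 H (theta q) ∗ pf2 H (theta p)))).
Proof. by rewrite theta_cat !pf2_vcomp !vcompA pf_comp_nat. Qed.

End Functor.
End Theta.

Arguments eta_unit : clear implicits.

(** * Pseudonatural transformations and modifications *)

Section Extend.
Variables (A B : bicategory) (F G : pseudofunctor (st A) B).
Local Notation stA := (st A).

Lemma pn1_theta (s : pseudonat F G) (a b : stA) (p : hom a b) :
  pn1 s p = (pf2 G (theta_inv p) ▷ s a)
    • (pn1 s (unary (eps p)) • (s b ◁ pf2 F (theta p))).
Proof.
by rewrite pn1_nat (vrea (whiskerrK _ (pf_thetaK G p))) vcomp1c.
Qed.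

(** The data of a pseudonatural transformation between the restrictions of [F]
    and [G] along [eta A]. They are spelled out with the unfolded constraints
    because the boundaries involved are then syntactically values of [F] and
    [G], as the rewriting below requires. *)
Variable s0 : forall a : stA, hom (F a) (G a).
Variable s1 : forall (a b : stA) (f : @hom A a b),
  s0 b ∘ pf1 F (unary f) ⟹ pf1 G (unary f) ∘ s0 a.
Hypothesis s1_inv : forall (a b : stA) (f : @hom A a b), invertible (s1 f).
Hypothesis s1_nat : forall (a b : stA) (f g : @hom A a b) (x : f ⟹ g),
  s1 g • (s0 b ◁ pf2 F (eta2 x)) = (pf2 G (eta2 x) ▷ s0 a) • s1 f.
Hypothesis s1_unit : forall a : stA,
  s1 (@id1 A a) • (s0 a ◁ (pf2 F (eta_unit A a) • pf_unit F a))
  = ((pf2 G (eta_unit A a) • pf_unit G a) ▷ s0 a)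
    • (lunit_inv (s0 a) • runit (s0 a)).
Hypothesis s1_comp : forall (a b c : stA) (g : @hom A b c) (f : @hom A a b),
  s1 (g ∘ f)
    • (s0 c ◁ (pf2 F (eta_comp g f) • pf_comp F (unary g) (unary f)))
  = ((pf2 G (eta_comp g f) • pf_comp G (unary g) (unary f)) ▷ s0 a)
    • (assoc_inv (pf1 G (unary g)) (pf1 G (unary f)) (s0 a)
      • ((pf1 G (unary g) ◁ s1 f)
      • (assoc (pf1 G (unary g)) (s0 b) (pf1 F (unary f))
      • ((s1 g ▷ pf1 F (unary f))
      • assoc_inv (s0 c) (pf1 F (unary g)) (pf1 F (unary f)))))).

(** By [pn1_theta], the only possible extension of [s1] to all paths *)
Definition extend_cell (a b : stA) (p : hom a b) :
    s0 b ∘ pf1 F p ⟹ pf1 G p ∘ s0 a :=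
  (pf2 G (theta_inv p) ▷ s0 a) • (s1 (eps p) • (s0 b ◁ pf2 F (theta p))).

Lemma extend_cellE (a b : stA) (p : hom a b) :
  (pf2 G (theta p) ▷ s0 a) • extend_cell p
  = s1 (eps p) • (s0 b ◁ pf2 F (theta p)).
Proof.
by rewrite /extend_cell (vrea (whiskerrK _ (pf_theta_invK G p))) vcomp1c.
Qed.

Lemma theta_cancel (a b : stA) (p : hom a b) (f : hom (F a) (G b))
    (x y : f ⟹ pf1 G p ∘ s0 a) :
  (pf2 G (theta p) ▷ s0 a) • x = (pf2 G (theta p) ▷ s0 a) • y -> x = y.
Proof.
apply: invertible_cancell; exists (pf2 G (theta_inv p) ▷ s0 a).
by split; apply: whiskerrK; [exact: pf_thetaK | exact: pf_theta_invK].
Qed.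

Lemma extend_cell_inv (a b : stA) (p : hom a b) : invertible (extend_cell p).
Proof.
repeat apply: invertible_vcomp; [|exact: s1_inv|];
  apply: invertible_hcomp; try exact: invertible_id2; apply: invertible_pf2.
  by exists (theta p); rewrite thetaK theta_invK.
by exists (theta_inv p); rewrite thetaK theta_invK.
Qed.

Lemma extend_cell_nat (a b : stA) (p q : hom a b) (x : p ⟹ q) :
  extend_cell q • (s0 b ◁ pf2 F x) = (pf2 G x ▷ s0 a) • extend_cell p.
Proof.
apply: theta_cancel; rewrite (vrea (extend_cellE q)) vcompA -whiskerl_vcomp.
rewrite pf_theta_nat whiskerl_vcomp (vrea (s1_nat _)) vcompA -extend_cellE.
by rewrite !(vrea (eq_sym (whiskerr_vcomp _ _ _))) pf_theta_nat.
Qed.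

Lemma extend_cell_unit (a : stA) :
  extend_cell (id1 a) • (s0 a ◁ pf_unit F a)
  = (pf_unit G a ▷ s0 a) • (lunit_inv (s0 a) • runit (s0 a)).
Proof.
apply: theta_cancel; rewrite (vrea (extend_cellE _)) vcompA -whiskerl_vcomp.
by rewrite theta_nil s1_unit whiskerr_vcomp vcompA.
Qed.

(** After composing with the invertible [theta (q ∘ p)], [theta_cat] turns both
    sides into the composition axiom of [s1] at [eps q] and [eps p], precomposed
    with [theta q ∗ theta p]; the two factors [theta] then slide through the
    associators by naturality. *)
Lemma extend_cell_comp (a b c : stA) (q : hom b c) (p : hom a b) :
  extend_cell (q ∘ p) • (s0 c ◁ pf_comp F q p)
  = (pf_comp G q p ▷ s0 a) • (assoc_inv (pf1 G q) (pf1 G p) (s0 a)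
      • ((pf1 G q ◁ extend_cell p) • (assoc (pf1 G q) (s0 b) (pf1 F p)
      • ((extend_cell q ▷ pf1 F p) • assoc_inv (s0 c) (pf1 F q) (pf1 F p))))).
Proof.
apply: theta_cancel.
rewrite (vrea (extend_cellE _)) vcompA -whiskerl_vcomp pf_theta_cat.
rewrite (vrea (eq_sym (whiskerr_vcomp _ _ _))) pf_theta_cat.
rewrite whiskerl_vcomp [in RHS]whiskerr_vcomp (vrea (s1_nat _)) !vcompA.
congr (_ • _).
rewrite -[X in s0 c ◁ X]vcompA -[X in X ▷ s0 a]vcompA.
rewrite whiskerl_vcomp whiskerr_vcomp (vrea (s1_comp _ _)) !vcompA.
congr (_ • _).
rewrite (vrea (eq_sym (assoc_inv_nat _ _ _))) !vcompA; congr (_ • _).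
rewrite (vrea (eq_sym (hcomp_vcomp _ _ _ _))) extend_cellE vcompc1.
rewrite -[pf2 G (theta q)]vcomp1c hcomp_vcomp !vcompA; congr (_ • _).
rewrite (vrea (eq_sym (assoc_nat _ _ _))) !vcompA; congr (_ • _).
rewrite (vrea (eq_sym (hcomp_vcomp _ _ _ _))) extend_cellE vcompc1.
rewrite -[pf2 F (theta p) in RHS]vcomp1c hcomp_vcomp !vcompA; congr (_ • _).
by rewrite assoc_inv_nat.
Qed.

Definition extend_pseudonat : pseudonat F G :=
  @Pseudonat _ _ F G s0 extend_cell extend_cell_inv extend_cell_nat
    extend_cell_unit extend_cell_comp.

Lemma extend_cell_unary (a b : stA) (f : @hom A a b) :
  extend_cell (unary f) = s1 f.
Proof.
rewrite /extend_cell theta_unary theta_inv_unary !pf2_id2 !hcomp_id2.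
by rewrite vcomp1c vcompc1.
Qed.

End Extend.

Section Precomposition.
Variables (A : bicategory) (B : bicategory) (F G : pseudofunctor (st A) B).
Local Notation eta := (eta A).

Lemma pseudonat_precomp_inj (s t : pseudonat F G) :
  pseudonat_precomp eta s = pseudonat_precomp eta t -> s = t.
Proof.
move=> e.
have e0 a : s a = t a := f_equal (fun u : pseudonat (pseudofunctor_comp F eta)
  (pseudofunctor_comp G eta) => u a) e.
apply: pseudonat_eq => // a b p; rewrite (pn1_theta s p) (pn1_theta t p).
have hid c : id2 (s c) ≈ id2 (t c) by apply: heq2_id2.
apply: heq2_vcomp; first exact: heq2_hcomp.
by apply: heq2_vcomp; [exact (heq2_pn1 (eps p) e) | exact: heq2_hcomp].
Qed.

Lemma pseudonat_precomp_bijective :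
  bijective (fun s : pseudonat F G => pseudonat_precomp eta s).
Proof.
move=> s.
pose t := @extend_pseudonat A B F G (pn0 s) (fun a b f => pn1 s f)
  (fun a b f => pn1_inv s f) (fun a b f g x => pn1_nat s x)
  (fun a => pn1_unit s a) (fun a b c g f => pn1_comp s g f).
have et : pseudonat_precomp eta t = s.
  apply: pseudonat_eq => // a b f; apply: heq2_of_eq; exact: extend_cell_unary.
exists t; split=> // t' e; apply: pseudonat_precomp_inj; by rewrite e.
Qed.

Lemma modification_precomp_bijective (s t : pseudonat F G) :
  bijective (fun m : modification s t => modification_precomp eta m).
Proof.
move=> m; pose m0 (a : st A) : s a ⟹ t a := m a.
have mP (a b : st A) (p : hom a b) :
    pn1 t p • (m0 b ▷ pf1 F p) = (pf1 G p ◁ m0 a) • pn1 s p.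
  have h : pn1 t (unary (eps p)) • (m0 b ▷ pf1 F (unary (eps p)))
    = (pf1 G (unary (eps p)) ◁ m0 a) • pn1 s (unary (eps p)) :=
    md0_nat m (eps p).
  rewrite (pn1_theta s p) (pn1_theta t p) !vcompA hcomp_lr -(hcomp_rl (m0 b)).
  by rewrite (vrea h) !vcompA (vrea (hcomp_rl _ _)) (vrea (hcomp_lr _ _)).
exists (@Modification _ _ _ _ s t m0 mP); split; first exact: modification_eq.
by move=> n e; apply: modification_eq => a; rewrite /= /m0 -e.
Qed.

End Precomposition.

(** * Strict extension of a pseudofunctor *)

Lemma cat_cell_snoc (A : bicategory) (a b c : A) (p : path a b) (f : hom b c) :
  cat_cell p (unary f) = snoc_cell_inv p f.
Proof. by rewrite [LHS]/= unit_middle vcompc1. Qed.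

Section ExtendFunctor.
Variables (A : bicategory) (B : two_category) (H : pseudofunctor A B).

Fixpoint ext_hom (a b : A) (p : path a b) : hom (H a) (H b) :=
  match p with
  | pnil => id1 (H a)
  | psnoc q f => pf1 H f ∘ ext_hom q
  end.

(** The comparison of the composite of the values of [H] with the value at the
    composite. The factor [snoc_cell_inv] accounts for [eps] of a unary path
    being [f] rather than [f ∘ id1 a]. *)
Fixpoint kappa (a b : A) (p : path a b) : ext_hom p ⟹ pf1 H (eps p) :=
  match p in path _ b return ext_hom p ⟹ pf1 H (eps p) with
  | pnil => pf_unit H a
  | psnoc q f => pf2 H (snoc_cell_inv q f)
      • (pf_comp H f (eps q) • (pf1 H f ◁ kappa q))
  end.

Lemma invertible_kappa (a b : A) (p : path a b) : invertible (kappa p).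
Proof.
elim: p => [|b' c p IH f]; first exact: pf_unit_inv.
apply: invertible_vcomp.
  apply: invertible_pf2; exists (snoc_cell p f).
  by split; [exact: snoc_cell_invK | exact: snoc_cellK].
apply: invertible_vcomp; first exact: pf_comp_inv.
by apply: invertible_hcomp; first exact: invertible_id2.
Qed.

Definition ext_cell (a b : A) (p q : path a b) (x : eps p ⟹ eps q) :
    ext_hom p ⟹ ext_hom q :=
  inv2 (invertible_kappa q) • (pf2 H x • kappa p).

Lemma kappa_ext_cell (a b : A) (p q : path a b) (x : eps p ⟹ eps q) :
  kappa q • ext_cell x = pf2 H x • kappa p.
Proof. by rewrite /ext_cell (vrea (inv2_K _)) vcomp1c. Qed.

Lemma ext_hom_cat (a b c : A) (p : path a b) (q : path b c) :
  ext_hom q ∘ ext_hom p = ext_hom (pcat p q).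
Proof.
elim: q => [|c1 d q IH f] /=; last rewrite -IH.
  by case: (strict_lunit (two_strict B) (ext_hom p)).
by case: (strict_assoc (two_strict B) (pf1 H f) (ext_hom q) (ext_hom p)).
Qed.

Lemma ext_cell_id2 (a b : A) (p : path a b) :
  ext_cell (id2 (eps p)) = id2 (ext_hom p).
Proof. by rewrite /ext_cell pf2_id2 vcomp1c inv2K. Qed.

Lemma ext_cell_vcomp (a b : A) (p q r : path a b)
  (y : eps q ⟹ eps r) (x : eps p ⟹ eps q) :
  ext_cell (y • x) = ext_cell y • ext_cell x.
Proof.
apply: (invertible_cancell (invertible_kappa r)).
rewrite (vrea (kappa_ext_cell y)) kappa_ext_cell vcompA.
by rewrite kappa_ext_cell pf2_vcomp vcompA.
Qed.

(** The comparison [kappa] of a concatenation, computed from its two parts *)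
Definition kappa2 (a b c : A) (p : path a b) (q : path b c) :
    ext_hom q ∘ ext_hom p ⟹ pf1 H (eps (pcat p q)) :=
  pf2 H (cat_cell p q) • (pf_comp H (eps q) (eps p) • (kappa q ∗ kappa p)).

(** The two comparisons have provably equal, but not convertible, sources. When
    an entry is appended to [q], the coherence axiom of [H] for associators
    moves it past [p], at the cost of an associator of [B]; that associator is
    an identity, as is the unitor in the case of the empty path. *)
Lemma kappa_cat (a b c : A) (p : path a b) (q : path b c) :
  kappa (pcat p q) ≈ kappa2 p q.
Proof.
elim: q => [|c' d q IH f].
  rewrite /kappa2 [cat_cell _ _]/= [kappa pnil]/= -hcomp_rl.
  rewrite (vrea3 (pf_lunit H _)) lunit_nat; apply: heq2_sym.
  exact: heq2_idr (strict_lunit (two_strict B) _).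
have -> : kappa2 p (psnoc q f) = pf2 H (snoc_cell_inv (pcat p q) f)
    • (pf_comp H f (eps (pcat p q)) • ((pf1 H f ◁ kappa2 p q)
    • assoc (pf1 H f) (ext_hom q) (ext_hom p))).
  rewrite /kappa2 [cat_cell p (psnoc q f)]/= [kappa (psnoc q f)]/=.
  rewrite !pf2_vcomp !vcompA; congr (_ • _).
  rewrite -[kappa p in LHS]vcomp1c hcomp_vcomp.
  rewrite (vrea (pf_comp_natr H _ _)) !vcompA.
  rewrite (vrea (eq_sym (whiskerr_vcomp _ _ _))) -pf2_vcomp snoc_cell_invK.
  rewrite pf2_id2 hcomp_id2 vcomp1c.
  rewrite -[kappa p in LHS]vcomp1c hcomp_vcomp.
  rewrite (vrea3 (pf_assoc H _ _ _)) !vcompA assoc_nat.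
  by rewrite (vrea (pf_comp_natl H _ _)) !whiskerl_vcomp !vcompA.
apply: heq2_vcomp => //; apply: heq2_vcomp => //.
apply: heq2_trans (heq2_sym (heq2_idr _ (strict_assoc (two_strict B) _ _ _))).
exact: heq2_hcomp.
Qed.

Lemma invertible_kappa2 (a b c : A) (p : path a b) (q : path b c) :
  invertible (kappa2 p q).
Proof.
apply: invertible_vcomp; first exact: invertible_pf2 (invertible_cat_cell _ _).
apply: invertible_vcomp; first exact: pf_comp_inv.
apply: invertible_hcomp; exact: invertible_kappa.
Qed.

(** Horizontal composition in [st A] is conjugation by [cat_cell], which
    [kappa2] absorbs. *)
Lemma ext_cell_hcomp (a b c : A) (q q' : path b c) (p p' : path a b)
  (y : eps q ⟹ eps q') (x : eps p ⟹ eps p') :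
  ext_cell (path_hcomp y x) ≈ ext_cell y ∗ ext_cell x.
Proof.
have -> : ext_cell y ∗ ext_cell x = inv2 (invertible_kappa2 p' q')
    • (pf2 H (path_hcomp y x) • kappa2 p q).
  apply: (invertible_cancell (invertible_kappa2 p' q')).
  rewrite (vrea (inv2_K _)) vcomp1c /kappa2 /path_hcomp !vcompA -hcomp_vcomp.
  rewrite !kappa_ext_cell !pf2_vcomp !vcompA; congr (_ • _).
  rewrite [in RHS](vrea (eq_sym (pf2_vcomp H _ (cat_cell p q)))).
  rewrite cat_cellK pf2_id2 vcomp1c.
  by rewrite (vrea (pf_comp_nat H _ _)) vcompA hcomp_vcomp.
apply: heq2_vcomp.
  exact: heq2_inverse (inv2K _) (inv2_K _) (kappa_cat _ _).
by apply: heq2_vcomp => //; exact: kappa_cat.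
Qed.

Definition extend_functor : two_functor (st A) B :=
  @strict_functor_of (st A) B (pf0 H) ext_hom ext_cell (fun a => eq_refl)
    (fun a b c q p => ext_hom_cat p q) ext_cell_id2 ext_cell_vcomp ext_cell_hcomp.

(** The unit axiom of [H] identifies this comparison with a right unitor of
    [B]. *)
Lemma kappa_unary (a b : A) (f : hom a b) : is_identity (kappa (unary f)).
Proof. by rewrite /= pf_runit; exact: (strict_runit (two_strict B)). Qed.

Lemma ext_cell_unary (a b : A) (p : path a b) (f : hom a b) (x : eps p ⟹ f) :
  ext_cell (x : eps p ⟹ eps (unary f)) ≈ pf2 H x • kappa p.
Proof.
by apply: heq2_idl; apply: is_identity_inverse (inv2K _) (kappa_unary f).
Qed.

Lemma extend_functor_precomp : pseudofunctor_comp extend_functor (eta A) = H.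
Proof.
apply: pseudofunctor_eq => [a b f g x|a|a b c g f].
- apply: heq2_trans (ext_cell_unary (p := unary f) _) _.
  exact: heq2_idr (kappa_unary f).
- apply: heq2_trans (heq2_idr _ _) _; first by eexists.
  apply: heq2_trans (ext_cell_unary (p := pnil) _) _.
  by rewrite pf2_id2 vcomp1c.
- apply: heq2_trans (heq2_idr _ _) _; first by eexists.
  apply: heq2_trans (ext_cell_unary (p := psnoc (unary f) g) _) _.
  rewrite [kappa _]/= !pf2_id2 !vcomp1c; apply: heq2_idr.
  by apply: is_identity_hcomp; [exact: is_identity_id2 | exact: kappa_unary].
Qed.

End ExtendFunctor.

Section ExtendRestriction.
Variables (A : bicategory) (B : two_category) (F : pseudofunctor (st A) B).
Hypothesis sF : is_strict_functor F.

(** Both sides obey the same recursion along the path, since the composition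
    constraint of [F ∘ eta] is the image under [F] of the one of [eta]. *)
Lemma theta_kappa (a b : A) (p : path a b) :
  pf2 F (theta (p : @hom (st A) a b))
  ≈ kappa (pseudofunctor_comp F (eta A)) p.
Proof.
elim: p => [|b' c p IH f].
  by apply: heq2_sym; apply: heq2_idr; exact (strict_unit sF a).
rewrite (@theta_cat A a b' c p (unary f)) cat_cell_snoc !pf2_vcomp.
apply: heq2_vcomp => //.
apply: heq2_vcomp.
  apply: heq2_sym; apply: heq2_idr.
  exact (strict_comp sF (unary f) (unary (eps p))).
apply: (heq2_trans (strict_pf2_hcomp sF (theta (unary f : @hom (st A) b' c))
  (theta (p : @hom (st A) a b')))).
by rewrite theta_unary pf2_id2; exact: heq2_hcomp.
Qed.

(** Every 2-cell of [st A] is conjugate by [theta] to one in the image of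
    [eta A], and [F] sends [theta] to [kappa]. *)
Lemma extend_functor_restriction :
  two_pf (extend_functor (pseudofunctor_comp F (eta A))) = F.
Proof.
apply: strict_functor_eq => // [|a b p q x]; first exact: two_functor_strict.
have -> : pf2 F x = pf2 F (theta_inv q)
    • (pf2 F (eta2 (x : eps p ⟹ eps q)) • pf2 F (theta p)).
  by rewrite -pf_theta_nat (vrea (pf_thetaK _ _)) vcomp1c.
apply: heq2_sym; apply: heq2_vcomp.
  exact: heq2_inverse (pf_thetaK _ _) (inv2_K _) (theta_kappa _).
by apply: heq2_vcomp => //; exact: theta_kappa.
Qed.

End ExtendRestriction.

Theorem corollary3p6 (A : bicategory) (B : two_category) :
  is_isomorphism
    (two_functor_comp (hom_precomp (eta A) B) (ps_incl (st A) B)).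
Proof.
apply: bijective_is_isomorphism.
- move=> H; exists (exist _ _ (two_functor_strict (extend_functor H))).
  split=> [|[F sF] e]; first exact: extend_functor_precomp.
  apply: subset_eq_compat; rewrite -e; exact: extend_functor_restriction.
- move=> F G; exact: pseudonat_precomp_bijective.
- move=> F G s t; exact: modification_precomp_bijective.
Qed.
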